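(* Let $n\ge r\ge1$ be integers and let $n=q_1r+r_1$ with $0\le r_1<r$. Then for every $s=1,\dots,q_1$, $$\underbrace{\Delta^r\cdots\Delta^r}_{s}\, I(\mu_{n,r}) = I(\mu_{n,r})+(\psi_0,\dots,\psi_{sr-1}).$$
   Context: Write $f(x)=x^n+a_{n-1}x^{n-1}+\cdots+a_0$, $g(x)=x^r+b_{r-1}x^{r-1}+\cdots+b_0$ and $f(x)g(x)=x^{n+r}+c_{n+r-1}x^{n+r-1}+\cdots+c_0$, so each $c_j$ is a polynomial in the coordinates $(a_0,\dots,a_{n-1},b_0,\dots,b_{r-1})$ of $\mathbb{C}^n\times\mathbb{C}^r$. Let $\mathcal{A}$ be the algebra of germs at the origin of holomorphic functions on $\mathbb{C}^n\times\mathbb{C}^r$, and $I(\mu_{n,r})\subset\mathcal{A}$ the ideal generated by $c_0,\dots,c_{n+r-1}$. For an ideal $J\subset\mathcal{A}$, $\Delta_kJ$ is the ideal generated by $J$ and all $k\times k$ minors of the matrices of first partial derivatives (with respect to the $n+r$ coordinates) of finite families of functions in $J$, and $\Delta^iJ=\Delta_{n+r-i+1}J$. Define polynomials $d_{n-1},\dots,d_0$ in the $a$'s and $b$'s by $d_n=1$ and $d_{n-j}=a_{n-j}-\sum_{k=1}^{\min(j,r)}b_{r-k}\,d_{n-j+k}$ for $1\le j\le n$. Put $\psi_i=d_i$ for $0\le i\le r-1$, and $\psi_{sr+i}=\dfrac{\partial^s d_{r-1}}{\partial b_0^{\,s-1}\,\partial b_{r-1-i}}$ for $0\le i\le r-1$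 and $1\le s\le q_1-1$, where derivatives are taken in the coordinates $(a,b)$. *)

(* Defs.v *)
From HB Require Import structures.
From mathcomp Require Import all_boot all_order all_algebra.
From mathcomp Require Import all_classical all_reals all_analysis.
Set Implicit Arguments.
Unset Strict Implicit.
Unset Printing Implicit Defensive.
Import Order.TTheory GRing.Theory Num.Theory.
Import numFieldNormedType.Exports.
Local Open Scope classical_set_scope.
Local Open Scope ring_scope.

(* Everything is meant for C = R[i] with R : realType; the definitions take
   C : numFieldType because R[i] gets its norm topology through that structure.

   Germs at the origin of holomorphic functions on C^m are handled through
   representatives: a germ is given by a function 'rV[C]_m -> C that is
   differentiable over C (Frechet) at every point of a neighbourhood of 0, and
   two functions represent the same germ when they agree near 0. An ideal of
   germs is the set of all representatives of its elements. *)
Section Germs.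
Variables (C : numFieldType) (m : nat).
Local Notation V := ('rV[C]_m).

Definition holomorphic0 (f : V -> C) : Prop :=
  \forall x \near (0 : V), differentiable f x.

Definition ideal_gen (S : set (V -> C)) : set (V -> C) :=
  [set f | holomorphic0 f /\
    exists (k : nat) (h g : 'I_k -> V -> C),
      [/\ forall i, holomorphic0 (h i),
          forall i, S (g i) &
          \forall x \near (0 : V), f x = \sum_(i < k) h i x * g i x]].

Definition ideal_add (I J : set (V -> C)) : set (V -> C) :=
  [set f | exists g h : V -> C,
     [/\ I g, J h & \forall x \near (0 : V), f x = g x + h x]].

(* Coordinates are numbered 0, ..., m - 1; [coord] is 0 out of range. *)
Definition coord (k : nat) (x : V) : C :=
  if insub k is Some i then x 0 i else 0.

Definition partial (k : nat) (f : V -> C) : V -> C :=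
  fun x => 'D_(\row_j (j == k :> nat)%:R : V) f x.

Definition jacobian (p : nat) (F : 'I_p -> V -> C) (x : V) : 'M[C]_(p, m) :=
  \matrix_(i, j) partial j (F i) x.

Definition jacobian_minors (k : nat) (J : set (V -> C)) : set (V -> C) :=
  [set D | exists (p : nat) (F : 'I_p -> V -> C)
                  (u : 'I_k -> 'I_p) (v : 'I_k -> 'I_m),
     [/\ forall i, J (F i),
         {homo u : i j / (i < j)%N},
         {homo v : i j / (i < j)%N} &
         D = fun x => \det (mxsub u v (jacobian F x))]].

Definition Delta_lo (k : nat) (J : set (V -> C)) : set (V -> C) :=
  ideal_gen (J `|` jacobian_minors k J).

Definition Delta_up (i : nat) (J : set (V -> C)) : set (V -> C) :=
  Delta_lo (m - i + 1) J.

End Germs.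

(* A point of C^n x C^r is the row (a_0, ..., a_(n-1), b_0, ..., b_(r-1)). *)
Section PolynomialProduct.
Variables (C : numFieldType) (n r : nat).
Local Notation V := ('rV[C]_(n + r)).

Definition ca (i : nat) : V -> C := coord i.
Definition cb (i : nat) : V -> C := coord (n + i).

Definition poly_f (x : V) : {poly C} := 'X^n + \poly_(i < n) ca i x.
Definition poly_g (x : V) : {poly C} := 'X^r + \poly_(i < r) cb i x.
Definition cc (j : nat) (x : V) : C := (poly_f x * poly_g x)`_j.

Definition Imu : set (V -> C) :=
  ideal_gen [set c | exists2 j : nat, (j < n + r)%N & c = cc j].

(* [dseq j] is [:: d_(n-j); d_(n-j+1); ...; d_n]; see [dd_n] and [dd_rec]. *)
Fixpoint dseq (j : nat) (x : V) : seq C :=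
  if j is j'.+1 then
    (ca (n - j) x - \sum_(1 <= k < (minn j r).+1)
                      cb (r - k) x * (dseq j' x)`_(k - 1)) :: dseq j' x
  else [:: 1].

Definition dd (i : nat) (x : V) : C := (dseq (n - i) x)`_0.

Definition psi (k : nat) : V -> C :=
  let s := (k %/ r)%N in let i := (k %% r)%N in
  if s == 0%N then dd i
  else iter (s - 1) (partial n) (partial (n + (r - 1 - i)) (dd (r - 1))).

Definition psi_ideal (k : nat) : set (V -> C) :=
  ideal_gen [set p | exists2 i : nat, (i < k)%N & p = psi i].

Lemma dd_n (x : V) : dd n x = 1.
Proof. by rewrite /dd subnn. Qed.

Lemma nth_dseq (j k : nat) (x : V) : (k <= j)%N -> (j <= n)%N ->
  (dseq j x)`_k = dd (n - j + k) x.
Proof.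
elim: j k => [|j IH] [|k] //= le_kj le_jn.
- by rewrite subn0 addn0 dd_n.
- by rewrite addn0 /dd subKn.
- by rewrite IH ?(ltnW le_jn) // -addSnnS -subSn // subSS.
Qed.

Lemma dd_rec (j : nat) (x : V) : (1 <= j <= n)%N ->
  dd (n - j) x = ca (n - j) x -
    \sum_(1 <= k < (minn j r).+1) cb (r - k) x * dd (n - j + k) x.
Proof.
case: j => // j /= le_jn; rewrite {1}/dd subKn //=; congr (_ - _).
apply: eq_big_nat => -[|k] // /andP[_]; rewrite ltnS leq_min => /andP[le_kj _].
by rewrite subn1 nth_dseq ?(ltnW le_jn) // -addSnnS -subSn // subSS.
Qed.

End PolynomialProduct.

Arguments Imu : clear implicits.
Arguments psi_ideal : clear implicits.
Arguments Delta_up : clear implicits.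

(* Main.v *)
(* Let J_s be generated by the coefficients c_j of f g and by all the coefficients of
   negative powers of x in the expansions at infinity of f/g, ..., f/g^s. Up to the factor
   (-1)^t t!, psi_(t r + i) is the coefficient of x^(i - r) in f/g^(t+1), and the relation
   g (f/g^(t+1)) = f/g^t recovers the other coefficients, so J_s = I + (psi_0, ..., psi_(sr-1)).

   Let q be the polynomial part of f/g and let v_i (i < r) be the vector field adding x^i to g
   and - x^i q to f. Then v_i (f g) = x^i (f - q g) and, modulo J_1,
   v_i (f/g^t) = - (t+1) x^i f/g^(t+1); hence v_i maps J_s to J_(s+1). So, modulo J_(s+1), the
   columns b_i of the Jacobian matrix of functions in J_s are combinations of the n columns
   a_l, and the (n+1)-minors lie in J_(s+1). Conversely, the minor with rows
   c_r, ..., c_(n+r-1), F and columns a_0, ..., a_(n-1), b_0 is exactly v_0 F, and the v_0 F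
   with F in J_s supply the missing generators of J_(s+1).

   That the minors lie in J_(s+1) uses that the partial derivatives of a holomorphic germ are
   again holomorphic, which needs Cauchy's theory as holomorphy only means complex
   differentiability. Goursat's bisection is run on dyadic Riemann sums over rectangles in the
   coordinate log (zeta): it shows that the directional derivative of f is the limit of averages
   over a circle of difference quotients of f. These averages are holomorphic and uniformly
   bounded, hence satisfy a uniform second order Taylor estimate, which passes to the limit. *)

From HB Require Import structures.
From mathcomp Require Import all_boot all_order all_algebra.
From mathcomp Require Import all_classical all_reals all_analysis.
From mathcomp Require Import complex perm zify ring lra.
Require Import Defs.

Set Implicit Arguments.
Unset Strict Implicit.
Unset Printing Implicit Defensive.
Import Order.TTheory GRing.Theory Num.Theory.
Import numFieldNormedType.Exports.
Local Open Scope classical_set_scope.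
Local Open Scope ring_scope.

(** * Holomorphic functions have holomorphic partial derivatives *)

Section RealNorm.
Local Open Scope complex_scope.
Variable R : realType.
Notation C := (R[i] : numFieldType).
(** Norms over [C] take values in [C], whose order is only partial; the estimates are made with this
    real number instead. *)
Definition rnorm (V : normedModType C) (x : V) : R := complex.Re `|x|.

Lemma rnormE (V : normedModType C) (x : V) : `|x| = (rnorm x)%:C.
Proof. by rewrite /rnorm RRe_real // ; apply: normr_real. Qed.

Lemma rnorm_ge0 (V : normedModType C) (x : V) : 0 <= rnorm x.
Proof. by rewrite -lecR -rnormE; exact: normr_ge0. Qed.

Lemma rnorm0 (V : normedModType C) : rnorm (0 : V) = 0.
Proof. by rewrite /rnorm normr0. Qed.

Lemma rnormN (V : normedModType C) (x : V) : rnorm (- x) = rnorm x.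
Proof. by rewrite /rnorm normrN. Qed.

Lemma rnormD (V : normedModType C) (x y : V) : rnorm (x + y) <= rnorm x + rnorm y.
Proof. by rewrite -lecR rmorphD /= -!rnormE ler_normD. Qed.

Lemma rnormB (V : normedModType C) (x y : V) : rnorm (x - y) = rnorm (y - x).
Proof. by rewrite -rnormN opprB. Qed.

Lemma rnormZ (V : normedModType C) (a : C) (x : V) : rnorm (a *: x) = rnorm a * rnorm x.
Proof. by apply/(@complexI R); rewrite rmorphM /= -!rnormE normrZ. Qed.

Lemma rnormM (a x : C) : rnorm (a * x) = rnorm a * rnorm x.
Proof. exact: (rnormZ a (x : C^o)). Qed.

Lemma rnormR (a : R) : rnorm (a%:C : C) = `|a|.
Proof. by rewrite /rnorm normc_def /= expr0n addr0 sqrtr_sqr. Qed.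

Lemma rnorm_eq0 (V : normedModType C) (x : V) : rnorm x = 0 -> x = 0.
Proof. move=> h; apply/eqP; by rewrite -normr_eq0 rnormE h. Qed.

Lemma rnorm_ball (V : normedModType C) (x : V) (P : set V) :
  nbhs x P <-> exists2 d : R, 0 < d & forall h, rnorm h < d -> P (x + h).
Proof.
split.
  move=> /nbhs_normP[e /= e0 he].
  have er : e = (complex.Re e)%:C by rewrite RRe_real // realE ltW.
  exists (complex.Re e); first by rewrite -ltcR -er.
  move=> h hd; apply: he; rewrite /= opprD addNKr normrN rnormE er.
  by rewrite ltcR.
move=> [d d0 hd]; apply/nbhs_normP; exists d%:C; first by rewrite /= ltcR.
move=> y /=; rewrite rnormE ltcR rnormB => h.
by rewrite -(subrK x y) addrC; exact: hd.
Qed.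

Lemma diff_eps (V W : normedModType C) (f : V -> W) x :
  differentiable f x -> forall e : R, 0 < e -> exists2 d : R, 0 < d &
  forall h, rnorm h < d -> rnorm (f (x + h) - f x - 'D_h f x) <= e * rnorm h.
Proof.
move=> df e e0; have /diff_locally /eqaddoP := df.
have ec : 0 < (e%:C : C) by rewrite ltcR.
move=> /(_ _ ec) /rnorm_ball[d d0 hd]; exists d => // h /hd.
rewrite add0r /= deriveE // !fctE /= -lecR rmorphM /= -!rnormE.
by rewrite opprD addrA (addrC h).
Qed.

(** Uniqueness of the differential identifies the candidate [L] with ['d f x]. *)
Lemma eps_diff (V W : normedModType C) (f : V -> W) x
   (L : {linear V -> W}) : continuous L ->
  (forall e : R, 0 < e -> exists2 d : R, 0 < d &
  forall h, rnorm h < d -> rnorm (f (x + h) - f x - L h) <= e * rnorm h) ->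
  differentiable f x.
Proof.
move=> cL H.
have E : f \o shift x = cst (f x) + L +o_ 0 id.
  apply/eqaddoP => e e0.
  have er : e = (complex.Re e)%:C by rewrite RRe_real // realE ltW.
  have e0' : 0 < complex.Re e by rewrite -ltcR -er.
  have [d d0 hd] := H _ e0'; apply/rnorm_ball; exists d => // h /hd.
  by rewrite add0r /= !fctE /= -lecR rmorphM /= -er -!rnormE opprD addrA (addrC h).
apply/diff_locallyP; rewrite (diff_unique cL E).
by split.
Qed.
End RealNorm.

(** * Bisection of rectangles *)

Section Bisection.
Local Open Scope complex_scope.
Variable R : realType.
Implicit Types (P : R -> R -> R -> R -> Prop).

Lemma small_dyadic (w d : R) : 0 < d -> exists k : nat, w / 2 ^+ k < d.
Proof.
move=> d0; exists (Num.truncn `|w / d|).+1.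
rewrite ltr_pdivrMr ?exprn_gt0 // mulrC -ltr_pdivrMr //.
apply: le_lt_trans (ler_norm _) _.
apply: lt_le_trans (truncnS_gt _) _.
by rewrite -natrX ler_nat ltnW // ltn_expl.
Qed.

(** The common point is the supremum of the left endpoints, since each of these lies below every
    right endpoint. *)
Lemma nested_dyadic (x : nat -> R) (w : R) : 0 <= w ->
  (forall k, x k <= x k.+1 /\ x k.+1 + w / 2 ^+ k.+1 <= x k + w / 2 ^+ k) ->
  exists p, forall k, x k <= p <= x k + w / 2 ^+ k.
Proof.
move=> w0 H.
have mono j k : (x j <= x (j + k)%N) && (x (j + k)%N + w / 2 ^+ (j + k) <= x j + w / 2 ^+ j).
  elim: k => [|k /andP[h1 h2]]; first by rewrite addn0 !lexx.
  have [h3 h4] := H (j + k)%N.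
  by rewrite addnS (le_trans h1 h3) (le_trans h4 h2).
have wk k : 0 <= w / 2 ^+ k by rewrite divr_ge0 // exprn_ge0.
have ub j k : x j <= x k + w / 2 ^+ k.
  have [jk|/ltnW kj] := leqP j k.
    have /andP[h _] := mono j (k - j)%N; rewrite subnKC // in h.
    by apply: (le_trans h); rewrite lerDl.
  have /andP[_ h] := mono k (j - k)%N; rewrite subnKC // in h.
  by apply: le_trans h; rewrite lerDl.
have hs : has_sup (range x).
  split; first by exists (x 0%N); exists 0%N.
  by exists (x 0%N + w / 2 ^+ 0) => _ [j _ <-].
exists (sup (range x)) => k; apply/andP; split.
  by apply: ub_le_sup; [case: hs|exists k].
by apply: ge_sup; [case: hs|move=> _ [j _ <-]].
Qed.

(** If [P] failed on the rectangle with corner (a, b) and sides w, h, it would fail on one of its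
    quarters, and so on. These nested rectangles shrink to a point, around which the local
    hypothesis makes [P] hold. Degenerate rectangles are allowed, so the lemma also serves on
    segments. *)
Lemma bisection P (a b w h : R) : 0 <= w -> 0 <= h ->
  (forall a b w h, 0 <= w -> 0 <= h ->
    P a b (w / 2) (h / 2) -> P (a + w / 2) b (w / 2) (h / 2) ->
    P a (b + h / 2) (w / 2) (h / 2) -> P (a + w / 2) (b + h / 2) (w / 2) (h / 2) ->
    P a b w h) ->
  (forall s t, a <= s <= a + w -> b <= t <= b + h -> exists2 d : R, 0 < d &
    forall a' b' w' h', 0 <= w' < d -> 0 <= h' < d ->
      a' <= s <= a' + w' -> b' <= t <= b' + h' -> P a' b' w' h') ->
  P a b w h.
Proof.
move=> w0 h0 half loc; apply: contrapT => nP.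
pose T := (R * R)%type.
(* [good k x] says that the rectangle of generation k with corner x is a counterexample to [P]. *)
pose good k (x : T) := ~ P x.1 x.2 (w / 2 ^+ k) (h / 2 ^+ k).
have half2 (u : R) k : u / 2 ^+ k / 2 = u / 2 ^+ k.+1.
  by rewrite exprS invfM mulrCA mulrC.
have step k (x : T) : good k x -> exists y : T, good k.+1 y /\
   (y.1 = x.1 \/ y.1 = x.1 + w / 2 ^+ k.+1) /\ (y.2 = x.2 \/ y.2 = x.2 + h / 2 ^+ k.+1).
  { move=> gx; apply: contrapT => nex; apply: gx.
  have wk (u : R) j : 0 <= u -> 0 <= u / 2 ^+ j by move=> ?; rewrite divr_ge0 // exprn_ge0.
  apply: half => //; try exact: wk.
  all: rewrite !half2; apply: contrapT => ng; apply: nex.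
  - exists (x.1, x.2); split => //; split; by left.
  - exists (x.1 + w / 2 ^+ k.+1, x.2); split => //; split; [by right|by left].
  - exists (x.1, x.2 + h / 2 ^+ k.+1); split => //; split; [by left|by right].
  - exists (x.1 + w / 2 ^+ k.+1, x.2 + h / 2 ^+ k.+1); split => //; split; by right. }
have /choice[F HF] : forall kx : nat * T, exists y : T, good kx.1 kx.2 -> good kx.1.+1 y /\
   (y.1 = kx.2.1 \/ y.1 = kx.2.1 + w / 2 ^+ kx.1.+1) /\ (y.2 = kx.2.2 \/ y.2 = kx.2.2 + h / 2 ^+ kx.1.+1).
  move=> [k x]; have [g|ng] := pselect (good k x).
    by have [y hy] := step _ _ g; exists y.
  by exists x => /ng.
pose X := fix X k := if k is k'.+1 then F (k', X k') else (a, b).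
have gX k : good k (X k).
  elim: k => [|k IH]; first by rewrite /good /= expr0 !divr1.
  by have [] := HF (k, X k) IH.
have nest (u v : R) k x y : 0 <= u -> (y = x \/ y = x + u / 2 ^+ k.+1) ->
   x <= y /\ y + u / 2 ^+ k.+1 <= x + u / 2 ^+ k.
  move=> u0; have -> : u / 2 ^+ k = u / 2 ^+ k.+1 + u / 2 ^+ k.+1.
    by rewrite -half2 -splitr.
  have : 0 <= u / 2 ^+ k.+1 by rewrite divr_ge0 // exprn_ge0.
  by move: (u / _) => z z0 [->|->]; split; lra.
have [p hp] : exists p, forall k, (X k).1 <= p <= (X k).1 + w / 2 ^+ k.
  apply: nested_dyadic => // k; apply: nest => //.
  by have [_ []] := HF (k, X k) (gX k).
have [q hq] : exists p, forall k, (X k).2 <= p <= (X k).2 + h / 2 ^+ k.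
  apply: nested_dyadic => // k; apply: nest => //.
  by have [_ []] := HF (k, X k) (gX k).
have [] := loc p q.
- by have := hp 0%N; rewrite expr0 divr1.
- by have := hq 0%N; rewrite expr0 divr1.
move=> d d0 hd.
have [k kd] := small_dyadic (w + h) d0.
apply: (gX k); apply: hd => //.
- rewrite divr_ge0 ?exprn_ge0 //=; apply: le_lt_trans kd.
  by rewrite ler_pM2r ?invr_gt0 ?exprn_gt0 // lerDl.
- rewrite divr_ge0 ?exprn_ge0 //=; apply: le_lt_trans kd.
  by rewrite ler_pM2r ?invr_gt0 ?exprn_gt0 // lerDr.
Qed.
End Bisection.

(** * Goursat's theorem for dyadic Riemann sums *)

Section Goursat.
Local Open Scope complex_scope.
Variable R : realType.
Notation C := (R[i] : numFieldType).

(* Average of [phi] over the left endpoints of the 2^N equal subintervals of [a, a+w]. *)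
Fixpoint dyadic_avg N (phi : R -> C) (a w : R) : C :=
  if N is N'.+1 then
    (dyadic_avg N' phi a (w / 2) + dyadic_avg N' phi (a + w / 2) (w / 2)) / 2
  else phi a.

Lemma dyadic_avgS N phi a w : dyadic_avg N.+1 phi a w =
  (dyadic_avg N phi a (w / 2) + dyadic_avg N phi (a + w / 2) (w / 2)) / 2.
Proof. by []. Qed.

Lemma dyadic_avgB N (phi psi : R -> C) a w :
  dyadic_avg N (fun u => phi u - psi u) a w =
  dyadic_avg N phi a w - dyadic_avg N psi a w.
Proof. by elim: N a w => // N IH a w; rewrite !dyadic_avgS !IH; field. Qed.

Lemma dyadic_avg_le N (phi : R -> C) a w M : 0 <= w ->
  (forall u, a <= u <= a + w -> rnorm (phi u) <= M) -> rnorm (dyadic_avg N phi a w) <= M.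
Proof.
elim: N a w => [|N IH] a w w0 h; first by apply: h; rewrite lexx lerDl.
rewrite dyadic_avgS.
rewrite mulrC rnormM.
have -> : rnorm (2^-1 : C) = 2^-1.
  have -> : (2^-1 : C) = (2^-1 : R)%:C by rewrite fmorphV rmorph_nat.
  by rewrite rnormR ger0_norm.
rewrite mulrC ler_pdivrMr //; apply: le_trans (rnormD _ _) _.
rewrite (_ : M * 2 = M + M); last by ring.
rewrite lerD //; apply: IH; rewrite ?divr_ge0 // => u /andP[h1 h2];
  apply: h; apply/andP; split; lra.
Qed.

Lemma dyadic_avg_cst N (c : C) a w : dyadic_avg N (fun _ => c) a w = c.
Proof. by elim: N a w => // N IH a w; rewrite !dyadic_avgS !IH; field. Qed.

Definition imag_unit : C := 0 +i* 1.
Definition of_real (x : R) : C := x%:C.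

(* Dyadic Riemann sum of [G (s + i t) d(s + i t)] along the boundary of a rectangle. *)
Definition boundary_sum N (G : R -> R -> C) (a b w h : R) : C :=
  of_real w * (dyadic_avg N (G ^~ b) a w - dyadic_avg N (G ^~ (b + h)) a w) +
  imag_unit * of_real h * (dyadic_avg N (G (a + w)) b h - dyadic_avg N (G a) b h).

(** The inner sides are run through twice in opposite directions and cancel. The identity is exact
    because an average of depth N+1 is the mean of two averages of depth N. *)
Lemma boundary_sum_half N G a b w h :
  boundary_sum N.+1 G a b w h =
  boundary_sum N G a b (w / 2) (h / 2) + boundary_sum N G (a + w / 2) b (w / 2) (h / 2) +
  boundary_sum N G a (b + h / 2) (w / 2) (h / 2) +
  boundary_sum N G (a + w / 2) (b + h / 2) (w / 2) (h / 2).
Proof.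
rewrite /boundary_sum !dyadic_avgS -!addrA -!splitr.
have E (x : R) : of_real (x / 2) = of_real x / 2 :> C by rewrite /of_real fmorph_div rmorph_nat.
by rewrite !E; field.
Qed.

(** An affine function of s + i t has boundary sum 0 at every depth, because opposite sides are
    sampled at the same parameters. Only the remainder [r] contributes. *)
Lemma boundary_sum_local (G : R -> R -> C) s t (d : C) e N a b w h :
  0 <= w -> 0 <= h -> 0 <= e -> a <= s <= a + w -> b <= t <= b + h ->
  (forall u v, a <= u <= a + w -> b <= v <= b + h ->
    rnorm (G u v - G s t - d * ((u - s) +i* (v - t) : C)) <= e * (w + h)) ->
  rnorm (boundary_sum N G a b w h) <= 2 * e * (w + h) ^+ 2.
Proof.
move=> w0 h0 e0 /andP[s1 s2] /andP[t1 t2] H.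
pose r u v := G u v - G s t - d * ((u - s) +i* (v - t) : C).
have K (x y : R) : (x +i* y : C) = of_real x + imag_unit * of_real y.
  by apply/eqP; rewrite eq_complex /= !(mul0r, mulr0, mul1r, addr0, add0r, subr0) !eqxx.
rewrite /boundary_sum -!dyadic_avgB.
pose c1 := d * imag_unit * of_real h; pose c2 := d * of_real w.
have -> : (fun u => G u b - G u (b + h)) = (fun u => (r u b - r u (b + h)) - c1).
  apply/funext => u; rewrite /r /c1 !K /of_real !rmorphB rmorphD; ring.
have -> : (fun u => G (a + w) u - G a u) = (fun u => (r (a + w) u - r a u) - (- c2)).
  apply/funext => u; rewrite /r /c2 !K /of_real !rmorphB rmorphD; ring.
rewrite (dyadic_avgB _ _ (fun _ => c1)) (dyadic_avgB _ _ (fun _ => - c2)) !dyadic_avg_cst.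
rewrite (_ : _ + _ = of_real w * dyadic_avg N (fun u => r u b - r u (b + h)) a w +
   imag_unit * of_real h * dyadic_avg N (fun u => r (a + w) u - r a u) b h); last first.
  rewrite /c1 /c2; ring.
apply: le_trans (rnormD _ _) _; rewrite !rnormM !rnormR.
have -> : rnorm imag_unit = 1 by rewrite /rnorm normc_def /= expr0n expr1n add0r sqrtr1.
rewrite mul1r !ger0_norm //.
have B1 : rnorm (dyadic_avg N (fun u => r u b - r u (b + h)) a w) <= 2 * e * (w + h).
  apply: dyadic_avg_le => // u hu; apply: le_trans (rnormD _ _) _; rewrite rnormN.
  rewrite (_ : 2 * e * (w + h) = e * (w + h) + e * (w + h)); last by ring.
  rewrite lerD //; apply: H => //; apply/andP; split; lra.
have B2 : rnorm (dyadic_avg N (fun u => r (a + w) u - r a u) b h) <= 2 * e * (w + h).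
  apply: dyadic_avg_le => // u hu; apply: le_trans (rnormD _ _) _; rewrite rnormN.
  rewrite (_ : 2 * e * (w + h) = e * (w + h) + e * (w + h)); last by ring.
  rewrite lerD //; apply: H => //; apply/andP; split; lra.
rewrite expr2 mulrA mulrDr lerD // mulrC ler_wpM2r //.
Qed.


(** Complex differentiability at s + i t, in real coordinates so that rectangles can be
    subdivided. *)
Definition complex_diff (G : R -> R -> C) s t := exists d : C,
  forall e : R, 0 < e -> exists2 del : R, 0 < del & forall h k,
   `|h| < del -> `|k| < del ->
   rnorm (G (s + h) (t + k) - G s t - d * (h +i* k : C)) <= e * (`|h| + `|k|).

(** The bound [e' * (w + h) ^+ 2] is additive under quartering, so bisection reduces it to small
    rectangles around a point, where [boundary_sum_local] gives it. *)
Lemma goursat (G : R -> R -> C) a b w h : 0 <= w -> 0 <= h ->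
  (forall s t, a <= s <= a + w -> b <= t <= b + h -> complex_diff G s t) ->
  forall e : R, 0 < e -> exists N0, forall N, (N0 <= N)%N ->
  rnorm (boundary_sum N G a b w h) <= e.
Proof.
move=> w0 h0 dG e e0.
(* The added 1 keeps [c] positive when the rectangle is a point. *)
pose c := (w + h) ^+ 2 + 1; pose e' := e / c.
have c0 : 0 < c by rewrite ltr_wpDl // sqr_ge0.
have e'0 : 0 < e' by rewrite divr_gt0.
pose P a b w h := exists N0, forall N, (N0 <= N)%N ->
  rnorm (boundary_sum N G a b w h) <= e' * (w + h) ^+ 2.
suff : P a b w h.
  move=> [N0 HN]; exists N0 => N /HN /le_trans; apply.
  by rewrite -mulrA ler_piMr ?(ltW e0) // mulrC ler_pdivrMr // mul1r lerDl.
apply: bisection => //.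
  move=> {w0 h0 dG} a' b' w' h' w0 h0 [N1 H1] [N2 H2] [N3 H3] [N4 H4].
  (* The successor is the level of depth consumed by [boundary_sum_half]. *)
  exists (N1 + N2 + N3 + N4).+1 => -[//|N]; rewrite ltnS => hN.
  rewrite boundary_sum_half.
  have -> : e' * (w' + h') ^+ 2 = e' * (w' / 2 + h' / 2) ^+ 2 + e' * (w' / 2 + h' / 2) ^+ 2 +
    e' * (w' / 2 + h' / 2) ^+ 2 + e' * (w' / 2 + h' / 2) ^+ 2 by field.
  apply: le_trans (rnormD _ _) _; apply: lerD; last by apply: H4; lia.
  apply: le_trans (rnormD _ _) _; apply: lerD; last by apply: H3; lia.
  apply: le_trans (rnormD _ _) _; apply: lerD; last by apply: H2; lia.
  by apply: H1; lia.
move=> s t hs ht; have [d hd] := dG s t hs ht.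
have [del del0 Hdel] := hd (e' / 2) (divr_gt0 e'0 (ltr0n _ 2)).
exists del => // a' b' w' h' /andP[w'0 w'd] /andP[h'0 h'd] hs' ht'.
exists 0%N => N _.
rewrite (_ : e' = 2 * (e' / 2)); last by field.
apply: (boundary_sum_local (s := s) (t := t) (d := d)) => //.
  by rewrite divr_ge0 // ltW.
move=> u v /andP[u1 u2] /andP[v1 v2]; case/andP: hs' => s1 s2; case/andP: ht' => t1 t2.
have hu : `|u - s| <= w' by rewrite ler_norml; apply/andP; split; lra.
have hv : `|v - t| <= h' by rewrite ler_norml; apply/andP; split; lra.
have := Hdel (u - s) (v - t) (le_lt_trans hu w'd) (le_lt_trans hv h'd).
rewrite !(addrC _ (_ - _)) !subrK => /le_trans; apply.
by rewrite ler_wpM2l ?lerD // divr_ge0 // ltW.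
Qed.

(* The two horizontal sides cancel by periodicity. *)
Lemma periodic_avg (G : R -> R -> C) a w h : 0 <= w -> 0 < h ->
  (forall s t, a <= s <= a + w -> 0 <= t <= h -> complex_diff G s t) ->
  (forall s, G s h = G s 0) ->
  forall e : R, 0 < e -> exists N0, forall N, (N0 <= N)%N ->
  rnorm (dyadic_avg N (G (a + w)) 0 h - dyadic_avg N (G a) 0 h) <= e.
Proof.
move=> w0 h0 dG per e e0.
have [|N0 HN] := goursat (G := G) (a := a) (b := 0) w0 (ltW h0) _ (mulr_gt0 e0 h0).
  by move=> s t; rewrite add0r; exact: dG.
exists N0 => N /HN; rewrite /boundary_sum add0r.
rewrite (_ : G^~ h = G^~ 0); last by apply/funext => s; rewrite per.
rewrite subrr mulr0 add0r !rnormM rnormR.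
have -> : rnorm imag_unit = 1 by rewrite /rnorm normc_def /= expr0n expr1n add0r sqrtr1.
by rewrite mul1r gtr0_norm // mulrC ler_pM2r.
Qed.
End Goursat.

(** * The exponential coordinate *)

Section Polar.
Local Open Scope complex_scope.
Variable R : realType.
Notation C := (R[i] : numFieldType).

Lemma is_derive_eps (f : R -> R) (df : R) : is_derive (0 : R) (1 : R) f df ->
  forall e : R, 0 < e -> exists2 d : R, 0 < d &
  forall h, `|h| < d -> `|f h - f 0 - df * h| <= e * `|h|.
Proof.
move=> [dv dfE] e e0.
have df0 : differentiable f 0 by apply/derivable1_diffP.
have /diff_locally /eqaddoP /(_ _ e0) /nbhs_normP[d /= d0 hd] := df0.
exists d => // h hh.
have := hd h; rewrite /= sub0r normrN => /(_ hh).
rewrite !fctE /= addr0 opprD addrA.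
by rewrite diff1E // derive1E dfE /GRing.scale /= (mulrC h).
Qed.

Lemma rnorm_complex_le (x y : R) : rnorm (x +i* y : C) <= `|x| + `|y|.
Proof.
have -> : (x +i* y : C) = x%:C + (0 +i* 1) * y%:C.
  by apply/eqP; rewrite eq_complex /= !(mul0r, mulr0, mul1r, addr0, add0r, subr0) !eqxx.
apply: le_trans (rnormD _ _) _; rewrite rnormM !rnormR.
have -> : rnorm (0 +i* 1 : C) = 1 by rewrite /rnorm normc_def /= expr0n expr1n add0r sqrtr1.
by rewrite mul1r.
Qed.

(** The exponential of s + i t: circles around 0 become vertical segments of length 2 pi. *)
Definition cexp (s t : R) : C := (expR s * cos t) +i* (expR s * sin t).

Lemma rnorm_cexp s t : rnorm (cexp s t) = expR s.
Proof.
rewrite /rnorm normc_def /= !exprMn -mulrDr cos2Dsin2 mulr1 sqrtr_sqr.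
by rewrite ger0_norm // expR_ge0.
Qed.

Lemma cexpD s t h k : cexp (s + h) (t + k) = cexp s t * cexp h k.
Proof.
rewrite /cexp expRD cosD sinD; apply/eqP; rewrite eq_complex /=.
by apply/andP; split; apply/eqP; ring.
Qed.

Lemma cexp_neq0 s t : cexp s t != 0.
Proof.
apply/eqP => h; have := rnorm_cexp s t; rewrite h rnorm0 => /esym/eqP.
by rewrite gt_eqF // expR_gt0.
Qed.

(** The complex exponential has derivative 1 at 0; [cexpD] carries this to every other point. *)
Lemma cexp_local (e : R) : 0 < e -> exists2 d : R, 0 < d & forall h k : R,
  `|h| < d -> `|k| < d ->
  rnorm (cexp h k - 1 - (h +i* k : C)) <= e * (`|h| + `|k|).
Proof.
move=> e0.
have [d1 d10 H1] := is_derive_eps (is_derive_expR 0) (divr_gt0 e0 (ltr0n _ 4)).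
have [d2 d20 H2] := is_derive_eps (is_derive_cos 0) (divr_gt0 e0 (ltr0n _ 4)).
have [d3 d30 H3] := is_derive_eps (is_derive_sin 0) (divr_gt0 e0 (ltr0n _ 4)).
have [d4 d40 H4] := is_derive_eps (is_derive_expR 0) ltr01.
(* [d4] and 1/2 give |E - 1| <= 2|h| and E <= 2; e/8 controls the cross term (E - 1) k. *)
pose m := Num.min (Num.min d1 d2) (Num.min d3 (Num.min d4 (Num.min (1 / 2) (e / 8)))).
have m0 : 0 < m by rewrite !lt_min; do !(apply/andP; split) => //; rewrite divr_gt0.
exists m => // h k; rewrite !lt_min.
move=> /and3P[/andP[h1 _] _ /and3P[h4 hh he]] /and3P[/andP[_ k2] k3 /and3P[_ _ ke]].
have := H1 h h1; have := H4 h h4; have := H2 k k2; have := H3 k k3.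
rewrite expR0 sin0 cos0 oppr0 mul0r !subr0 addr0 !mul1r.
set E := expR h; set c := cos k; set s := sin k => A1 A2 A3 A4.
have -> : cexp h k - 1 - (h +i* k) = (E * c - 1 - h) +i* (E * s - k).
  by apply/eqP; rewrite eq_complex /= subr0 !eqxx.
apply: le_trans (rnorm_complex_le _ _) _.
have E0 : 0 < E by apply: expR_gt0.
have hE : `|E - 1| <= 2 * `|h|.
  have : `|E - 1| <= `|E - 1 - h| + `|h| by rewrite -[X in `|X| <= _](subrK h); apply: ler_normD.
  lra.
have E2 : E <= 2.
  have := ler_norm (E - 1); lra.
have -> : E * c - 1 - h = (E - 1 - h) + E * (c - 1) by ring.
have -> : E * s - k = E * (s - k) + (E - 1) * k by ring.
apply: le_trans (lerD (ler_normD _ _) (ler_normD _ _)) _.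
rewrite !normrM (gtr0_norm E0).
have B1 : E * `|c - 1| <= 2 * (e / 4 * `|k|) by apply: ler_pM => //; exact: ltW.
have B2 : E * `|s - k| <= 2 * (e / 4 * `|k|) by apply: ler_pM => //; exact: ltW.
have B3 : `|E - 1| * `|k| <= (2 * `|h|) * (e / 8) by apply: ler_pM => //; exact: ltW.
have hp : 0 <= `|h| by []. have kp : 0 <= `|k| by [].
have ehp : 0 <= e * `|h| by rewrite mulr_ge0 // ltW.
have ekp : 0 <= e * `|k| by rewrite mulr_ge0 // ltW.
lra.
Qed.

(** This is the chain rule: the exponential is its own derivative, so the derivative in the new
    coordinate is [D * w]. *)
Lemma complex_diff_polar (f : C -> C) s t : differentiable f (cexp s t) ->
  complex_diff (fun s t => f (cexp s t)) s t.
Proof.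
move=> df; set w := cexp s t.
have wE : rnorm w = expR s by apply: rnorm_cexp.
have E0 : 0 < expR s by apply: expR_gt0.
set D : C := 'D_1 f w.
have DE (x : C) : 'D_x f w = D * x.
  rewrite /D !deriveE //.
  have -> : x = x *: (1 : C) by rewrite /GRing.scale /= mulr1.
  by rewrite linearZ /GRing.scale /= mulrC mulr1.
exists (D * w) => e e0.
have c1 : 0 < e / (4 * expR s) by rewrite divr_gt0 // mulr_gt0.
have [d1 d10 H1] := diff_eps df c1.
(* [K] is chosen so that the error of the exponential, multiplied by [D * w], stays below e/2 times
   [S]. *)
pose K := 2 * (rnorm D * expR s + 1).
have K0 : 0 < K by rewrite mulr_gt0 // ltr_wpDl // mulr_ge0 ?rnorm_ge0 // ltW.
have m0 : 0 < Num.min 1 (e / K) by rewrite lt_min ltr01 divr_gt0.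
have [d2 d20 H2] := cexp_local m0.
exists (Num.min d2 (d1 / (4 * expR s))); first by rewrite lt_min d20 divr_gt0 // mulr_gt0.
move=> h k; rewrite !lt_min => /andP[h2 h1] /andP[k2 k1].
have := H2 h k h2 k2; set u : C := cexp h k - 1; set v : C := h +i* k => A.
rewrite cexpD -/w.
have -> : w * cexp h k = w + w * u by rewrite /u; ring.
set S := `|h| + `|k| in A *.
have S0 : 0 <= S by rewrite addr_ge0.
have A1 : rnorm (u - v) <= S by apply: le_trans A _; rewrite ler_piMl // ge_min lexx.
have A2 : rnorm (u - v) <= e / K * S by apply: le_trans A _; rewrite ler_wpM2r // ge_min lexx orbT.
have nu : rnorm u <= 2 * S.
  have : rnorm u <= rnorm (u - v) + rnorm v by rewrite -[X in rnorm X <= _](subrK v); apply: rnormD.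
  have := rnorm_complex_le h k; rewrite -/v -/S; lra.
have nwu : rnorm (w * u) < d1.
  rewrite rnormM wE; apply: le_lt_trans (_ : expR s * (2 * S) < _); first by rewrite ler_wpM2l // ltW.
  move: h1 k1; rewrite !ltr_pdivlMr ?mulr_gt0 // /S; lra.
have := H1 _ nwu; rewrite DE rnormM wE => B.
have -> : f (w + w * u) - f w - D * w * v =
   (f (w + w * u) - f w - D * (w * u)) + D * w * (u - v) by ring.
apply: le_trans (rnormD _ _) _; rewrite 2!rnormM wE.
have B2 : e / (4 * expR s) * (expR s * rnorm u) <= e / 2 * S.
  have -> : e / (4 * expR s) * (expR s * rnorm u) = e / 4 * rnorm u by field; rewrite gt_eqF.
  have : e / 4 * rnorm u <= e / 4 * (2 * S) by rewrite ler_wpM2l // divr_ge0 // ltW.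
  lra.
have B3 : rnorm D * expR s * rnorm (u - v) <= e / 2 * S.
  have h0 : 0 <= rnorm D * expR s by rewrite mulr_ge0 ?rnorm_ge0 // ltW.
  apply: le_trans (ler_wpM2l h0 A2) _.
  have -> : e / 2 * S = (rnorm D * expR s + 1) * (e / K * S).
    by rewrite /K; field; rewrite /= gt_eqF // ltr_wpDl.
  by apply: ler_wpM2r; [rewrite mulr_ge0 // divr_ge0 // ltW|rewrite lerDl].
lra.
Qed.
End Polar.

(** * Averages of difference quotients over circles *)

Section CauchyAverage.
Local Open Scope complex_scope.
Variable R : realType.
Notation C := (R[i] : numFieldType).
Variable V : normedModType C.

Lemma deriveZv (f : V -> C) x (c : C) v : differentiable f x ->
  'D_(c *: v) f x = c * 'D_v f x.
Proof. by move=> df; rewrite !deriveE // linearZ. Qed.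

Lemma mean_value_le (f : V -> C) z h (B : R) :
  (forall t : R, 0 <= t <= 1 -> differentiable f (z + (t%:C : C) *: h)) ->
  (forall t : R, 0 <= t <= 1 -> rnorm ('D_h f (z + (t%:C : C) *: h)) <= B) ->
  rnorm (f (z + h) - f z) <= B.
Proof.
move=> df DB; apply/ler_addgt0Pr => e e0.
(* The slack [e] absorbs the local error of differentiability. The bound is additive in [w], so
   bisection applies with a degenerate second side. *)
pose P (a b w k : R) := rnorm (f (z + ((a + w)%:C : C) *: h) - f (z + (a%:C : C) *: h)) <= (B + e) * w.
suff : P 0 0 1 0.
  by rewrite /P add0r rmorph0 rmorph1 scale0r scale1r addr0 mulr1.
apply: (bisection (P := P)) => //.
  move=> a b w k w0 k0; rewrite /P -!addrA -splitr => H1 H2 _ _.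
  have -> : (B + e) * w = (B + e) * (w / 2) + (B + e) * (w / 2) by field.
  apply: le_trans (lerD H2 H1); apply: le_trans (rnormD _ _).
  by rewrite addrA subrK.
move=> s t; rewrite add0r => hs _.
have n0 : 0 < rnorm h + 1 by rewrite ltr_wpDl // rnorm_ge0.
have [d d0 Hd] := diff_eps (df s hs) (divr_gt0 e0 n0).
exists (d / (rnorm h + 1)); first by rewrite divr_gt0.
move=> a b w k /andP[w0 wd] _ /andP[as1 as2] _; rewrite /P.
set D : C := 'D_h f (z + (s%:C : C) *: h).
have key u : `|u - s| <= w ->
    rnorm (f (z + (u%:C : C) *: h) - f (z + (s%:C : C) *: h) - (u - s)%:C * D) <= e * `|u - s|.
  move=> uw.
  have hd : rnorm (((u - s)%:C : C) *: h) < d.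
    rewrite rnormZ rnormR; move: wd; rewrite ltr_pdivlMr // => wd.
    apply: le_lt_trans wd; apply: ler_pM => //; first exact: rnorm_ge0.
    by rewrite lerDl.
  have := Hd _ hd; rewrite (deriveZv _ _ (df s hs)).
  have -> : z + (s%:C : C) *: h + ((u - s)%:C : C) *: h = z + (u%:C : C) *: h.
    by rewrite -addrA -scalerDl -rmorphD /= addrCA subrr addr0.
  rewrite rnormZ rnormR => /le_trans; apply.
  have -> : e / (rnorm h + 1) * (`|u - s| * rnorm h) = e * `|u - s| * (rnorm h / (rnorm h + 1)).
    by field; rewrite gt_eqF.
  by rewrite ler_piMr ?mulr_ge0 ?(ltW e0) // ler_pdivrMr // mul1r lerDl.
have k1 : `|a + w - s| <= w by rewrite ler_norml; apply/andP; split; lra.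
have k2 : `|a - s| <= w by rewrite ler_norml; apply/andP; split; lra.
have [K1 K2] := (key _ k1, key _ k2).
rewrite (ger0_norm (_ : 0 <= a + w - s)) in K1; last lra.
rewrite (ler0_norm (_ : a - s <= 0)) in K2; last lra.
have DBs : rnorm (w%:C * D : C) <= B * w.
  by rewrite rnormM rnormR ger0_norm // mulrC ler_wpM2r // DB.
move: K1 K2; set x := f _; set x' := f (_ + a%:C *: h); set y := f _ => K1 K2.
have -> : x - x' = (x - y - (a + w - s)%:C * D) + - (x' - y - (a - s)%:C * D) + w%:C * D.
  by rewrite !rmorphB rmorphD; ring.
apply: le_trans (rnormD _ _) _; apply: le_trans (lerD (rnormD _ _) (lexx _)) _.
rewrite rnormN; lra.
Qed.

Definition diff_quot (f : V -> C) z v (w : C) : C := (f (z + w *: v) - f z) * w^-1.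

(** A Riemann sum of Cauchy's integral of (f (z + w v) - f z) / (2 pi i w^2) over the circle |w| =
    e^s. *)
Definition cauchy_avg (f : V -> C) v (s : R) N z : C :=
  dyadic_avg N (fun t => diff_quot f z v (cexp s t)) 0 (2 * pi).

(** By Goursat's theorem in log w, the averages over two concentric circles differ by a quantity
    tending to 0. On a small enough circle every difference quotient is already close to the
    derivative. *)
Lemma cauchy_avg_cvg (f : V -> C) z v (s : R) :
  (forall w : C, rnorm w <= expR s -> differentiable f (z + w *: v)) ->
  forall e : R, 0 < e -> exists N0, forall N, (N0 <= N)%N ->
  rnorm (cauchy_avg f v s N z - 'D_v f z) <= e.
Proof.
move=> df e e0.
have dfz : differentiable f z.
  by have := df 0; rewrite scale0r addr0; apply; rewrite rnorm0 expR_ge0.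
have n0 : 0 < rnorm v + 1 by rewrite ltr_wpDl // rnorm_ge0.
have [d d0 Hd] := diff_eps dfz (divr_gt0 e0 (mulr_gt0 (ltr0n _ 2) n0)).
have dn0 : 0 < d / (2 * (rnorm v + 1)) by rewrite divr_gt0 // mulr_gt0.
(* The inner circle lies inside the given one and keeps w v within distance [d]. *)
pose s0 := Num.min s (ln (d / (2 * (rnorm v + 1)))).
have s0s : s0 <= s by rewrite ge_min lexx.
have s0d : expR s0 <= d / (2 * (rnorm v + 1)).
  by rewrite -[leRHS]lnK ?posrE // ler_expR ge_min lexx orbT.
have small t : rnorm (diff_quot f z v (cexp s0 t) - 'D_v f z) <= e / 2.
  set w := cexp s0 t.
  have nw : rnorm w = expR s0 by apply: rnorm_cexp.
  have w0 : w != 0 by apply: cexp_neq0.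
  have hw : rnorm (w *: v) < d.
    rewrite rnormZ nw; move: s0d; rewrite ler_pdivlMr ?mulr_gt0 //.
    have := expR_gt0 s0; have := rnorm_ge0 v; move: (expR s0) (rnorm v) => x y y0 x0.
    have : 0 <= x * y by rewrite mulr_ge0 // ltW.
    lra.
  have := Hd _ hw; rewrite deriveZv // rnormZ => H.
  have -> : diff_quot f z v w - 'D_v f z = w^-1 * (f (z + w *: v) - f z - w * 'D_v f z).
    by rewrite mulrBr mulKf // /diff_quot mulrC.
  have nwi : rnorm (w^-1) = (rnorm w)^-1.
    apply: (@mulfI _ (rnorm w)); first by rewrite nw gt_eqF // expR_gt0.
    by rewrite -rnormM mulfV // mulfV ?nw ?gt_eqF ?expR_gt0 // -(rmorph1 (@real_complex R)) rnormR normr1.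
  rewrite rnormM nwi mulrC ler_pdivrMr ?nw ?expR_gt0 //.
  apply: le_trans H _; rewrite nw.
  have -> : e / (2 * (rnorm v + 1)) * (expR s0 * rnorm v) = (e / 2 * expR s0) * (rnorm v / (rnorm v + 1)).
    by field; rewrite gt_eqF.
  rewrite ler_piMr ?mulr_ge0 ?expR_ge0 ?divr_ge0 ?(ltW e0) //.
  by rewrite ler_pdivrMr // mul1r lerDl.
have pi2 : 0 < 2 * pi :> R by rewrite mulr_gt0 // pi_gt0.
have ws : 0 <= s - s0 by rewrite subr_ge0.
have [||N0 HN] := periodic_avg (G := fun s t => diff_quot f z v (cexp s t)) (a := s0) ws pi2 _ _
   (divr_gt0 e0 (ltr0n _ 2)).
- move=> u t /andP[_ us] _; apply: (@complex_diff_polar _ (diff_quot f z v)).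
  rewrite addrC subrK in us.
  have w0 : cexp u t != 0 by apply: cexp_neq0.
  apply: differentiableM; last exact: differentiable_Rinv.
  apply: differentiableB => //.
  apply: (differentiable_comp (f := fun w : C => z + w *: v)).
    by apply: differentiableD => //; apply: differentiableZl.
  by apply: df; rewrite rnorm_cexp ler_expR.
- by move=> u; rewrite /cexp (_ : 2 * pi = pi *+ 2) ?cos2pi ?sin2pi ?cos0 ?sin0 // mulr_natl.
exists N0 => N /HN; rewrite (addrC s0) subrK => H.
rewrite /cauchy_avg.
set x := dyadic_avg _ _ _ _ in H *; set y := dyadic_avg _ _ _ _ in H.
have -> : x - 'D_v f z = (x - y) + (y - 'D_v f z) by ring.
apply: le_trans (rnormD _ _) _.
rewrite (splitr e) lerD // /y -(dyadic_avg_cst N ('D_v f z) 0 (2 * pi)) -dyadic_avgB.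
by apply: dyadic_avg_le => // ; exact: ltW.
Qed.
End CauchyAverage.

(** * Cauchy estimates and the second order Taylor bound *)

Section CauchyEstimates.
Local Open Scope complex_scope.
Variable R : realType.
Notation C := (R[i] : numFieldType).

Lemma rnormV (w : C) : rnorm (w^-1) = (rnorm w)^-1.
Proof. by apply: (@complexI R); rewrite -rnormE normfV rnormE fmorphV. Qed.

Lemma rnorm_Re (w : C) : `|complex.Re w| <= rnorm w.
Proof. by rewrite -lecR -rnormE normc_ge_Re. Qed.

Lemma rnorm_Im (w : C) : `|complex.Im w| <= rnorm w.
Proof.
rewrite /rnorm normc_def /= -sqrtr_sqr ler_wsqrtr // lerDr; exact: sqr_ge0.
Qed.

Lemma real_cauchy_seq (u : nat -> R) :
  (forall e : R, 0 < e -> exists N0, forall N, (N0 <= N)%N -> `|u N - u N0| <= e) ->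
  exists l, forall e : R, 0 < e -> exists N0, forall N, (N0 <= N)%N -> `|u N - l| <= e.
Proof.
move=> H.
have cu : cvg (u @ \oo).
  apply/cauchy_cvgP/cauchy_exP => e e0.
  have [N0 HN] := H (e / 2) (divr_gt0 e0 (ltr0n _ 2)).
  exists (u N0); exists N0 => // N /= hN; rewrite -ball_normE /= distrC.
  apply: le_lt_trans (HN _ hN) _; lra.
exists (lim (u @ \oo)) => e e0.
have /cvgrPdist_le /(_ e e0) [N0 _ HN] := cu.
by exists N0 => N hN; rewrite distrC; apply: HN.
Qed.

Lemma complex_cauchy_seq (u : nat -> C) :
  (forall e : R, 0 < e -> exists N0, forall N, (N0 <= N)%N -> rnorm (u N - u N0) <= e) ->
  exists l : C, forall e : R, 0 < e -> exists N0, forall N, (N0 <= N)%N -> rnorm (u N - l) <= e.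
Proof.
move=> H.
have [|a Ha] := @real_cauchy_seq (fun N => complex.Re (u N)).
  move=> e e0; have [N0 HN] := H e e0; exists N0 => N hN.
  by rewrite -raddfB; apply: le_trans (rnorm_Re _) (HN _ hN).
have [|b Hb] := @real_cauchy_seq (fun N => complex.Im (u N)).
  move=> e e0; have [N0 HN] := H e e0; exists N0 => N hN.
  by rewrite -raddfB; apply: le_trans (rnorm_Im _) (HN _ hN).
exists (a +i* b) => e e0.
have [N1 H1] := Ha _ (divr_gt0 e0 (ltr0n _ 2)).
have [N2 H2] := Hb _ (divr_gt0 e0 (ltr0n _ 2)).
exists (N1 + N2)%N => N hN.
have -> : u N - (a +i* b) = (complex.Re (u N) - a) +i* (complex.Im (u N) - b).
  by case: (u N).
apply: le_trans (rnorm_complex_le _ _) _; rewrite (splitr e) lerD //; [apply: H1|apply: H2]; lia.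
Qed.

Section Estimates.
Variable V : normedModType C.
Implicit Types (f : V -> C).

Lemma diff_quot_le f z v (w : C) (M : R) :
  rnorm (f z) <= M -> rnorm (f (z + w *: v)) <= M -> rnorm (diff_quot f z v w) <= 2 * M / rnorm w.
Proof.
move=> h1 h2; rewrite /diff_quot rnormM rnormV ler_wpM2r ?invr_ge0 ?rnorm_ge0 //.
apply: le_trans (rnormD _ _) _; rewrite rnormN; lra.
Qed.

Definition bounded_diff f z r M := forall x, rnorm (x - z) <= r ->
  differentiable f x /\ rnorm (f x) <= M.

Lemma bounded_diffW f z r z' r' M : rnorm (z' - z) + r' <= r ->
  bounded_diff f z r M -> bounded_diff f z' r' M.
Proof.
move=> h b x hx; apply: b.
have -> : x - z = (x - z') + (z' - z) by rewrite addrA subrK.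
apply: le_trans (rnormD _ _) _; lra.
Qed.

Lemma bounded_diff_ge0 f z r M : 0 <= r -> bounded_diff f z r M -> 0 <= M.
Proof.
move=> r0 /(_ z); rewrite subrr rnorm0 => /(_ r0) [_]; apply: le_trans; exact: rnorm_ge0.
Qed.

(** On the circle |w| = rho / |h| the points z + w h stay in the ball, so the difference quotients
    are at most 2 M |h| / rho; their averages tend to the derivative. *)
Lemma cauchy_le f z h (rho M : R) : 0 < rho -> bounded_diff f z rho M ->
  rnorm ('D_h f z) <= 2 * M / rho * rnorm h.
Proof.
move=> rho0 bf.
have [h0|h0] := eqVneq (rnorm h) 0.
  by rewrite h0 mulr0 (rnorm_eq0 h0) derive0 rnorm0.
have nh : 0 < rnorm h by rewrite lt_def h0 rnorm_ge0.
apply/ler_addgt0Pr => e e0.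
have rh : 0 < rho / rnorm h by rewrite divr_gt0.
have Es : expR (ln (rho / rnorm h)) = rho / rnorm h by rewrite lnK ?posrE.
have good (w : C) : rnorm w <= rho / rnorm h -> rnorm (z + w *: h - z) <= rho.
  by move=> hw; rewrite addrC addKr rnormZ -ler_pdivlMr.
have [|N0 HN] := @cauchy_avg_cvg _ _ f z h (ln (rho / rnorm h)) _ e e0.
  by rewrite Es => w /good /bf [].
have {HN} := HN N0 (leqnn _); set c := cauchy_avg _ _ _ _ _ => Hc.
have Bc : rnorm c <= 2 * M / rho * rnorm h.
  apply: dyadic_avg_le; first by rewrite mulr_ge0 // pi_ge0.
  move=> t _.
  have -> : 2 * M / rho * rnorm h = 2 * M / rnorm (cexp (ln (rho / rnorm h)) t).
    by rewrite rnorm_cexp Es; field; rewrite !gt_eqF.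
  apply: diff_quot_le; first by apply bf; rewrite subrr rnorm0 ltW.
  by apply bf; apply: good; rewrite rnorm_cexp Es.
have -> : 'D_h f z = c - (c - 'D_h f z) by rewrite opprB addrC subrK.
by apply: le_trans (rnormD _ _) _; rewrite rnormN lerD.
Qed.

Lemma convex_ball (z x y : V) (t r : R) : 0 <= t <= 1 ->
  rnorm (x - z) <= r -> rnorm (y - z) <= r -> rnorm (x + (t%:C : C) *: (y - x) - z) <= r.
Proof.
move=> /andP[t0 t1] hx hy.
have -> : x + (t%:C : C) *: (y - x) - z = ((1 - t)%:C : C) *: (x - z) + (t%:C : C) *: (y - z).
  rewrite rmorphB rmorph1 scalerBl scale1r -[RHS]addrA (addrC (- _)) -scalerBr opprB.
  by rewrite addrA subrK addrAC.
apply: le_trans (rnormD _ _) _; rewrite !rnormZ !rnormR !ger0_norm //; last lra.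
have : (1 - t) * rnorm (x - z) <= (1 - t) * r by rewrite ler_wpM2l //; lra.
have : t * rnorm (y - z) <= t * r by rewrite ler_wpM2l //.
lra.
Qed.

(** The derivative is bounded by [cauchy_le] along the segment from x to y, each point of which has
    a margin [rho]. *)
Lemma cauchy_lipschitz f z x y (r rho M : R) : 0 < rho ->
  bounded_diff f z (r + rho) M -> rnorm (x - z) <= r -> rnorm (y - z) <= r ->
  rnorm (f y - f x) <= 2 * M / rho * rnorm (y - x).
Proof.
move=> rho0 bf hx hy.
have -> : f y = f (x + (y - x)) by rewrite addrC subrK.
apply: mean_value_le => t ht.
  apply bf; apply: le_trans (convex_ball ht hx hy) _; lra.
apply: cauchy_le => //; apply: (bounded_diffW _ bf).
by rewrite lerD2r; apply: convex_ball.
Qed.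

Lemma triangle_split (a b c d : C) : b - a = (d - c) - (d - b) + (c - a).
Proof. by ring. Qed.

(** The averages at y and x differ by the average of the quotients of (f (y + w h) - f (x + w h)) -
    (f y - f x) by w, and both differences obey [cauchy_lipschitz]. One margin [rho] covers the
    displacement w h, the other the Lipschitz estimate. *)
Lemma cauchy_derive_lipschitz f z x y h (r rho M : R) : 0 < rho ->
  bounded_diff f z (r + 2 * rho) M -> rnorm (x - z) <= r -> rnorm (y - z) <= r ->
  rnorm ('D_h f y - 'D_h f x) <= 4 * M / rho ^+ 2 * rnorm (y - x) * rnorm h.
Proof.
move=> rho0 bf hx hy.
have [h0|h0] := eqVneq (rnorm h) 0.
  by rewrite h0 mulr0 (rnorm_eq0 h0) !derive0 subrr rnorm0.
have nh : 0 < rnorm h by rewrite lt_def h0 rnorm_ge0.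
apply/ler_addgt0Pr => e e0.
have rh : 0 < rho / rnorm h by rewrite divr_gt0.
set s := ln (rho / rnorm h).
have Es : expR s = rho / rnorm h by rewrite lnK ?posrE.
have good u (w : C) : rnorm (u - z) <= r -> rnorm w <= rho / rnorm h -> rnorm (u + w *: h - z) <= r + rho.
  rewrite ler_pdivlMr // => hu hw; rewrite -addrA (addrC (_ *: _)) addrA.
  by apply: le_trans (rnormD _ _) _; rewrite rnormZ lerD.
have cv u : rnorm (u - z) <= r -> exists N0, forall N, (N0 <= N)%N ->
    rnorm (cauchy_avg f h s N u - 'D_h f u) <= e / 2.
  move=> hu; apply: cauchy_avg_cvg; last by rewrite divr_gt0.
  move=> w; rewrite Es => hw; apply bf; apply: le_trans (good _ _ hu hw) _; lra.
have [N1 H1] := cv _ hx; have [N2 H2] := cv _ hy.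
have {H1} := H1 (N1 + N2)%N (leq_addr _ _); have {H2} := H2 (N1 + N2)%N (leq_addl _ _).
set cy : C := cauchy_avg _ _ _ _ y; set cx : C := cauchy_avg _ _ _ _ x => Hy Hx.
have Bc : rnorm (cy - cx) <= 4 * M / rho ^+ 2 * rnorm (y - x) * rnorm h.
  rewrite /cx /cy /cauchy_avg -dyadic_avgB.
  apply: dyadic_avg_le; first by rewrite mulr_ge0 // pi_ge0.
  move=> t _; set w := cexp _ _.
  have nw : rnorm w = rho / rnorm h by rewrite rnorm_cexp Es.
  rewrite /diff_quot -mulrBl rnormM rnormV nw.
  have -> : 4 * M / rho ^+ 2 * rnorm (y - x) * rnorm h =
    (2 * M / rho * rnorm (y - x) + 2 * M / rho * rnorm (y - x)) / (rho / rnorm h).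
    by field; rewrite !gt_eqF.
  rewrite ler_wpM2r ?invr_ge0 ?(ltW rh) //.
  rewrite (_ : _ - _ = (f (y + w *: h) - f (x + w *: h)) - (f y - f x)); last by ring.
  apply: le_trans (rnormD _ _) _; rewrite rnormN.
  apply: lerD.
    have -> : y - x = (y + w *: h) - (x + w *: h) by rewrite opprD addrACA subrr addr0.
    apply: (cauchy_lipschitz (z := z) (r := r + rho)) => //; last 2 first.
    - by apply: good; rewrite ?nw.
    - by apply: good; rewrite ?nw.
    by rewrite -addrA -mulr2n -mulr_natl.
  apply: (cauchy_lipschitz (z := z) (r := r)) => //.
  apply: (bounded_diffW _ bf); rewrite subrr rnorm0 add0r lerD2l.
  by rewrite ler_peMl ?ler1n // ltW.
clearbody cx cy.
rewrite (triangle_split _ _ cx cy).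
apply: le_trans (rnormD _ _) _; apply: le_trans (lerD (rnormD _ _) (lexx _)) _; rewrite rnormN.
by rewrite [in leRHS](splitr e) addrA; exact: (lerD (lerD Bc Hy) Hx).
Qed.

(** The mean value bound is applied to f minus its differential at z, whose derivative along h is
    small near z by [cauchy_derive_lipschitz]. *)
Lemma cauchy_taylor f z h (rho M : R) : 0 < rho ->
  bounded_diff f z (3 * rho) M -> rnorm h <= rho ->
  rnorm (f (z + h) - f z - 'D_h f z) <= 4 * M / rho ^+ 2 * rnorm h ^+ 2.
Proof.
move=> rho0 bf hh.
have inb (t : R) : 0 <= t <= 1 -> rnorm (z + (t%:C : C) *: h - z) <= rnorm h.
  by move=> /andP[t0 t1]; rewrite addrC addKr rnormZ rnormR ger0_norm // ler_piMl // rnorm_ge0.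
have dfz : differentiable f z by apply bf; rewrite subrr rnorm0 mulr_ge0 // ltW.
have M0 : 0 <= M by apply: bounded_diff_ge0 bf; rewrite mulr_ge0 // ltW.
pose g : V -> C := f - ('d f z : V -> C).
have -> : f (z + h) - f z - 'D_h f z = g (z + h) - g z.
  rewrite /g !fctE linearD deriveE //; ring.
have dl x : differentiable ('d f z) x.
  by apply: linear_differentiable; apply: diff_continuous.
have df (t : R) : 0 <= t <= 1 -> differentiable f (z + (t%:C : C) *: h).
  by move=> /inb ht; apply bf; lra.
apply: mean_value_le => t ht; first by apply: differentiableB => //; apply: df.
have -> : 'D_h g (z + (t%:C : C) *: h) = 'D_h f (z + (t%:C : C) *: h) - 'D_h f z.
  rewrite /g (deriveB (diff_derivable (df t ht)) (diff_derivable (dl _))).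
  rewrite (deriveE h (dl _)) (deriveE h dfz) diff_lin //.
  exact: diff_continuous.
apply: le_trans (cauchy_derive_lipschitz (z := z) (r := rho) (rho := rho) (M := M) _ _ _ _ _) _ => //.
- by apply: (bounded_diffW _ bf); rewrite subrr rnorm0; lra.
- by rewrite subrr rnorm0 ltW.
- by apply: le_trans (inb _ ht) _.
rewrite expr2 !mulrA ler_wpM2r ?rnorm_ge0 // ler_wpM2l ?inb //.
by rewrite divr_ge0 ?mulr_ge0 ?sqr_ge0 // ltW.
Qed.
End Estimates.
End CauchyEstimates.

(** * Passage to the limit: derivatives of holomorphic functions are holomorphic *)

Section PartialHolomorphic.
Local Open Scope complex_scope.
Variable R : realType.
Notation C := (R[i] : numFieldType).

Lemma differentiable_dyadic_avg (V : normedModType C) (phi : V -> R -> C) x N a w :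
  (forall t, differentiable (phi^~ t) x) ->
  differentiable (fun z => dyadic_avg N (phi z) a w) x.
Proof.
move=> H; elim: N a w => [|N IH] a w; first exact: H.
apply: (differentiableM (f := fun z => dyadic_avg N (phi z) a (w / 2) + dyadic_avg N (phi z) (a + w / 2) (w / 2))
   (g := cst 2^-1)) => //.
exact: differentiableD.
Qed.

Lemma linear_bound_continuous (V : normedModType C) (L : {linear V -> C}) (B : R) :
  (forall h, rnorm (L h) <= B * rnorm h) -> continuous L.
Proof.
move=> H; apply/linear_bounded_continuous/bounded_funP => r.
(* The radius is a complex number; unless it is nonnegative, no x satisfies the norm bound. *)
have [r0|r0] := boolP (0 <= r); last first.
  exists 0 => x xr; case/negP: r0; exact: le_trans (normr_ge0 _) xr.
exists ((`|B|)%:C * r) => x xr; apply: le_trans (_ : (`|B|)%:C * `|x| <= _); last first.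
  by rewrite ler_wpM2l // lecR.
rewrite !rnormE -rmorphM lecR; apply: le_trans (H x) _.
by rewrite ler_wpM2r ?rnorm_ge0 ?ler_norm.
Qed.

(** Two functions that nearly agree at two points, and are each well approximated by their
    differential between them, have nearly equal differentials. This makes the differentials of the
    averages a Cauchy sequence. *)
Lemma diff_quot_split (c d1 d2 x1 x2 y1 y2 F G : C) (e1 e2 : R) :
  rnorm (y1 - x1 - c * d1) <= e1 -> rnorm (y2 - x2 - c * d2) <= e1 ->
  rnorm (y1 - G) <= e2 -> rnorm (x1 - F) <= e2 -> rnorm (y2 - G) <= e2 -> rnorm (x2 - F) <= e2 ->
  rnorm (c * (d1 - d2)) <= 2 * e1 + 4 * e2.
Proof.
move=> h1 h2 h3 h4 h5 h6.
have -> : c * (d1 - d2) = - (y1 - x1 - c * d1) + (y2 - x2 - c * d2) +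
     (y1 - G) + - (x1 - F) + - (y2 - G) + (x2 - F) by ring.
do 5 (apply: le_trans (rnormD _ _) _; rewrite -?lerBrDr).
rewrite !rnormN; lra.
Qed.

Lemma linear_split (a l lx ly dx dy : C) (e : R) :
  rnorm (a * dx + dy - l) <= e / 3 -> rnorm (dx - lx) <= e / 3 / (rnorm a + 1) ->
  rnorm (dy - ly) <= e / 3 -> rnorm (l - (a * lx + ly)) <= e.
Proof.
move=> h1 h2 h3.
have na : 0 < rnorm a + 1 by rewrite ltr_wpDl // rnorm_ge0.
have -> : l - (a * lx + ly) = - (a * dx + dy - l) + a * (dx - lx) + (dy - ly) by ring.
apply: le_trans (rnormD _ _) _; apply: le_trans (lerD (rnormD _ _) (lexx _)) _.
rewrite rnormN rnormM.
have : rnorm a * rnorm (dx - lx) <= e / 3.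
  apply: le_trans (_ : (rnorm a + 1) * (e / 3 / (rnorm a + 1)) <= _).
    by apply: ler_pM => //; rewrite ?rnorm_ge0 // lerDl.
  by rewrite mulrC divfK // gt_eqF.
lra.
Qed.

Lemma limit_split (y x d F G l : C) (B e : R) :
  rnorm (y - x - d) <= B -> rnorm (y - G) <= e / 3 -> rnorm (x - F) <= e / 3 ->
  rnorm (d - l) <= e / 3 -> rnorm (G - F - l) <= B + e.
Proof.
move=> h1 h2 h3 h4.
have -> : G - F - l = (y - x - d) + - (y - G) + (x - F) + (d - l) by ring.
do 3 (apply: le_trans (rnormD _ _) _; rewrite -?lerBrDr).
rewrite !rnormN; lra.
Qed.

(** The averages [g N] tend to the derivative and share one bound, so [cauchy_taylor] holds for them
    with a constant [K] independent of N. Their differentials at z converge to a bounded linear map,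
    and the Taylor estimate survives in the limit. The radius 5 rho is made of rho for z, 3 rho for
    [cauchy_taylor] and rho for the displacement w v. *)
Lemma derive_bounded_diff (V : normedModType C) (f : V -> C) v z (rho M : R) :
  0 < rho -> bounded_diff f 0 (5 * rho) M -> rnorm z <= rho ->
  differentiable (fun x => 'D_v f x) z.
Proof.
move=> rho0 bf hz.
have M0 : 0 <= M by apply: bounded_diff_ge0 bf; rewrite mulr_ge0 // ltW.
have n0 : 0 < rnorm v + 1 by rewrite ltr_wpDl // rnorm_ge0.
pose sig := rho / (rnorm v + 1).
have sig0 : 0 < sig by rewrite divr_gt0.
pose s := ln sig.
have Es : expR s = sig by rewrite lnK ?posrE.
have inb x (w : C) : rnorm (x - z) <= 3 * rho -> rnorm w <= sig -> rnorm (x + w *: v - 0) <= 5 * rho.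
  move=> hx hw; rewrite subr0.
  have -> : x + w *: v = (x - z) + z + w *: v by rewrite subrK.
  apply: le_trans (rnormD _ _) _; apply: le_trans (lerD (rnormD _ _) (lexx _)) _.
  rewrite rnormZ.
  have : rnorm w * rnorm v <= rho.
    apply: le_trans (_ : sig * (rnorm v + 1) <= _); last by rewrite /sig divfK // gt_eqF.
    by apply: ler_pM => //; rewrite ?rnorm_ge0 // lerDl.
  lra.
have inb0 x : rnorm (x - z) <= 3 * rho -> rnorm (x - 0) <= 5 * rho.
  by move=> hx; have := inb x 0 hx; rewrite scale0r addr0; apply; rewrite rnorm0 ltW.
pose g N := cauchy_avg f v s N.
pose M' := 2 * M / sig.
have bg N : bounded_diff (g N) z (3 * rho) M'.
  move=> x hx; have [dfx Mx] := bf _ (inb0 _ hx); split.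
    apply: (differentiable_dyadic_avg (phi := fun z t => diff_quot f z v (cexp s t))) => t.
    have hw : rnorm (cexp s t) <= sig by rewrite rnorm_cexp Es.
    have [dfx' _] := bf _ (inb x (cexp s t) hx hw).
    apply: (differentiableM (f := fun z => f (z + cexp s t *: v) - f z) (g := cst (cexp s t)^-1)) => //.
    apply: differentiableB => //.
    apply: (differentiable_comp (f := fun z => z + cexp s t *: v)) => //.
  apply: dyadic_avg_le; first by rewrite mulr_ge0 // pi_ge0.
  move=> t _; rewrite /M' -Es -(rnorm_cexp s t); apply: diff_quot_le => //.
  by apply bf; apply: inb => //; rewrite rnorm_cexp Es.
have cvg_g x : rnorm (x - z) <= 3 * rho -> forall e : R, 0 < e -> exists N0, forall N, (N0 <= N)%N ->
    rnorm (g N x - 'D_v f x) <= e.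
  move=> hx; apply: cauchy_avg_cvg => w; rewrite Es => hw.
  by have [] := bf _ (inb x w hx hw).
pose K := 4 * M' / rho ^+ 2.
have M'0 : 0 <= M' by apply: divr_ge0; [exact: mulr_ge0|exact: ltW].
have K0 : 0 <= K by apply: divr_ge0; [exact: mulr_ge0|exact: sqr_ge0].
have tay N h : rnorm h <= rho -> rnorm (g N (z + h) - g N z - 'D_h (g N) z) <= K * rnorm h ^+ 2.
  by move=> hh; apply: cauchy_taylor.
have zz : rnorm (z - z) <= 3 * rho by rewrite subrr rnorm0 mulr_ge0 // ltW.
have dg N : differentiable (g N) z by have [] := bg N _ zz.
have dcvg h : exists l : C, forall e : R, 0 < e -> exists N0, forall N, (N0 <= N)%N ->
    rnorm ('D_h (g N) z - l) <= e.
  apply: complex_cauchy_seq => e e0.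
  have nh : 0 < rnorm h + 1 by rewrite ltr_wpDl // rnorm_ge0.
  have nh0 := rnorm_ge0 h.
  (* Shrinking h by t makes the quadratic Taylor error at most t e / 4. With values within t e / 8
     of their limits, [diff_quot_split] gives the total t e, and t cancels. *)
  pose t := Num.min (rho / (rnorm h + 1)) (e / (4 * (K + 1) * (rnorm h + 1) ^+ 2)).
  have K1 : 0 < K + 1 by rewrite ltr_wpDl.
  have t0 : 0 < t by rewrite lt_min !divr_gt0 ?mulr_gt0 ?exprn_gt0.
  have nth : rnorm ((t%:C : C) *: h) = t * rnorm h by rewrite rnormZ rnormR gtr0_norm.
  have th : rnorm ((t%:C : C) *: h) <= rho.
    rewrite nth; apply: le_trans (_ : t * (rnorm h + 1) <= _); first by rewrite ler_pM2l // lerDl.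
    by rewrite -ler_pdivlMr // ge_min lexx.
  have tK : K * (t * rnorm h) ^+ 2 <= t * (e / 4).
    have : t * (4 * (K + 1) * (rnorm h + 1) ^+ 2) <= e.
      by rewrite -ler_pdivlMr ?mulr_gt0 ?exprn_gt0 // ge_min lexx orbT.
    have : t * (K * rnorm h ^+ 2) <= t * ((K + 1) * (rnorm h + 1) ^+ 2).
      rewrite ler_pM2l //; apply: ler_pM => //; rewrite ?sqr_ge0 // ?lerDl //.
      by rewrite lerXn2r ?nnegrE // ?lerDl // ltW.
    have -> : K * (t * rnorm h) ^+ 2 = t * (t * (K * rnorm h ^+ 2)) by ring.
    move=> A B; rewrite ler_pM2l //; lra.
  have te : 0 < t * e / 8 by rewrite divr_gt0 // mulr_gt0.
  have zth : rnorm (z + (t%:C : C) *: h - z) <= 3 * rho by rewrite addrC addKr; lra.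
  have [N1 H1] := cvg_g _ zth _ te; have [N2 H2] := cvg_g _ zz _ te.
  exists (N1 + N2)%N => N hN.
  have l1 : (N1 <= N1 + N2)%N by apply: leq_addr.
  have l2 : (N2 <= N1 + N2)%N by apply: leq_addl.
  have T1 := tay N _ th; have T2 := tay (N1 + N2)%N _ th.
  rewrite nth (deriveZv _ _ (dg _)) in T1; rewrite nth (deriveZv _ _ (dg _)) in T2.
  rewrite -(ler_pM2l t0) -[X in X * _ <= _](gtr0_norm t0) -rnormR -rnormM.
  apply: le_trans (diff_quot_split T1 T2 (H1 N (leq_trans l1 hN)) (H2 N (leq_trans l2 hN))
     (H1 _ l1) (H2 _ l2)) _.
  by move: tK; clear => tK; lra.
have [L HL] := choice dcvg.
have uniq (x y : C) : (forall e : R, 0 < e -> rnorm (x - y) <= e) -> x = y.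
  move=> H; apply/eqP; rewrite -subr_eq0; apply/eqP/rnorm_eq0/eqP.
  by rewrite eq_le rnorm_ge0 andbT; apply/ler_addgt0Pr => e /H; rewrite add0r.
have linL : linear L.
  move=> a x y; apply: uniq => e e0.
  have na : 0 < rnorm a + 1 by rewrite ltr_wpDl // rnorm_ge0.
  have e1 : 0 < e / 3 by rewrite divr_gt0.
  have e2 : 0 < e / 3 / (rnorm a + 1) by rewrite divr_gt0.
  have [N1 H1] := HL (a *: x + y) _ e1; have [N2 H2] := HL x _ e2.
  have [N3 H3] := HL y _ e1.
  set N := (N1 + N2 + N3)%N.
  have l1 : (N1 <= N)%N by rewrite /N -addnA leq_addr.
  have l2 : (N2 <= N)%N by rewrite /N addnAC leq_addl.
  have l3 : (N3 <= N)%N by rewrite /N leq_addl.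
  have A1 := H1 N l1; have A2 := H2 N l2; have A3 := H3 N l3.
  rewrite (deriveE _ (dg N)) linearP -!(deriveE _ (dg N)) in A1.
  move: A1 A2 A3; rewrite /GRing.scale /=; exact: linear_split.
have LB h : rnorm (L h) <= 2 * M' / rho * rnorm h.
  apply/ler_addgt0Pr => e e0; have [N HN] := HL h e e0.
  rewrite (_ : L h = 'D_h (g N) z - ('D_h (g N) z - L h)); last by rewrite opprB addrC subrK.
  apply: le_trans (rnormD _ _) _; rewrite rnormN lerD ?HN //.
  apply: cauchy_le => //; apply: (bounded_diffW _ (bg N)).
  by rewrite subrr rnorm0 add0r ler_peMl ?ler1n // ltW.
pose LL : {linear V -> C} := HB.pack L (GRing.isLinear.Build _ _ _ _ L linL).
apply: (eps_diff (L := LL) (linear_bound_continuous (L := LL) LB)) => e e0.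
have K1 : 0 < K + 1 by rewrite ltr_wpDl.
exists (Num.min rho (e / (K + 1))); first by rewrite lt_min rho0 divr_gt0.
move=> h; rewrite lt_min => /andP[h1 h2].
apply: le_trans (_ : K * rnorm h ^+ 2 <= _); last first.
  rewrite expr2 mulrA ler_wpM2r ?rnorm_ge0 //.
  move: h2; rewrite ltr_pdivlMr // => /ltW; apply: le_trans.
  by rewrite mulrC ler_wpM2l ?rnorm_ge0 // lerDl.
have zh : rnorm (z + h - z) <= 3 * rho.
  by rewrite addrC addKr; apply: le_trans (ltW h1) _; rewrite ler_peMl ?ler1n // ltW.
apply/ler_addgt0Pr => e1 e10.
have e3 : 0 < e1 / 3 by rewrite divr_gt0.
have [N1 H1] := cvg_g _ zh _ e3; have [N2 H2] := cvg_g _ zz _ e3; have [N3 H3] := HL h _ e3.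
set N := (N1 + N2 + N3)%N.
have l1 : (N1 <= N)%N by rewrite /N -addnA leq_addr.
have l2 : (N2 <= N)%N by rewrite /N addnAC leq_addl.
have l3 : (N3 <= N)%N by rewrite /N leq_addl.
exact: limit_split (tay N _ (ltW h1)) (H1 N l1) (H2 N l2) (H3 N l3).
Qed.

(** Continuity at 0 bounds f by |f 0| + 1 on a small ball, where [derive_bounded_diff] applies. *)
Lemma holomorphic0_partial m k (f : 'rV[C]_m -> C) :
  holomorphic0 f -> holomorphic0 (partial k f).
Proof.
move=> /rnorm_ball[d d0 Hd].
have df0 : differentiable f 0 by have := Hd 0; rewrite addr0; apply; rewrite rnorm0.
have /differentiable_continuous /cvgrPdist_lt /(_ 1 ltr01) /rnorm_ball [d' d'0 Hd'] := df0.
(* Dividing by 6 leaves 5 rho strictly below both radii. *)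
pose rho := Num.min d d' / 6.
have m0 : 0 < Num.min d d' by rewrite lt_min d0.
have rho0 : 0 < rho by rewrite divr_gt0.
have small x : rnorm x <= 5 * rho -> rnorm x < Num.min d d'.
  by move=> h; apply: le_lt_trans h _; rewrite mulrCA gtr_pMr // ltr_pdivrMr // mul1r ltr_nat.
clearbody rho.
suff H x : rnorm x < rho -> differentiable (partial k f) (0 + x).
  by apply/(@rnorm_ball _ _ 0 (fun x => differentiable (partial k f) x)); exists rho.
move=> xr; rewrite add0r.
suff bf : bounded_diff f 0 (5 * rho) (rnorm (f 0) + 1).
  exact: (derive_bounded_diff _ rho0 bf (ltW xr)).
move=> y; rewrite subr0 => /small; rewrite lt_min => /andP[y1 y2]; split.
  by have := Hd y y1; rewrite add0r.
have := Hd' y y2; rewrite add0r rnormE -[1]/(1%:C) ltcR => h.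
have -> : f y = f 0 - (f 0 - f y) by rewrite opprB addrC subrK.
by apply: le_trans (rnormD _ _) _; rewrite rnormN lerD // ltW.
Qed.
End PartialHolomorphic.

(** * Ideals of germs and derivations *)

Section Ideals.
Variables (C : numFieldType) (m : nat).
Local Notation V := ('rV[C]_m).
Implicit Types (f g h : V -> C) (J S : set (V -> C)).

Lemma near_eq_differentiable f g x :
  (\forall y \near x, f y = g y) -> differentiable f x -> differentiable g x.
Proof.
move=> fg df; have fgx : f x = g x := nbhs_singleton fg.
have E : g \o shift x = cst (g x) + 'd f x +o_ 0 id.
  apply/eqaddoP => e e0; have /diff_locally /eqaddoP /(_ _ e0) H := df.
  move: fg; rewrite (near_shift 0) subr0 => fg.
  near=> y.
  have -> : (g \o shift x - (cst (g x) + 'd f x)) y = (f \o shift x - (cst (f x) + 'd f x)) y.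
    by rewrite !fctE /= fgx; congr (_ - _); apply/esym; near: y.
  by near: y.
have dE := diff_unique (diff_continuous df) E.
apply/diff_locallyP; rewrite dE; split => //; exact: diff_continuous.
Unshelve. all: by end_near. Qed.

Lemma near_eq_holomorphic0 f g :
  (\forall x \near (0 : V), f x = g x) -> holomorphic0 f -> holomorphic0 g.
Proof.
move=> /near_join fg hf.
near=> x; apply: (@near_eq_differentiable f); last by near: x.
by near: x.
Unshelve. all: by end_near. Qed.

Lemma hol_everywhere f : (forall x, differentiable f x) -> holomorphic0 f.
Proof. by move=> H; near=> x; apply: H. Unshelve. all: by end_near. Qed.

Lemma hol_cst (a : C) : holomorphic0 (fun _ : V => a).
Proof. by apply: hol_everywhere => x; apply: differentiable_cst. Qed.

Lemma holD f g : holomorphic0 f -> holomorphic0 g -> holomorphic0 (fun x => f x + g x).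
Proof.
move=> hf hg; near=> x.
by apply: differentiableD; near: x.
Unshelve. all: by end_near. Qed.

Lemma holM f g : holomorphic0 f -> holomorphic0 g -> holomorphic0 (fun x => f x * g x).
Proof.
move=> hf hg; near=> x.
by apply: differentiableM; near: x.
Unshelve. all: by end_near. Qed.

Lemma holN f : holomorphic0 f -> holomorphic0 (fun x => - f x).
Proof.
move=> hf; near=> x.
by apply: differentiableN; near: x.
Unshelve. all: by end_near. Qed.

Lemma holB f g : holomorphic0 f -> holomorphic0 g -> holomorphic0 (fun x => f x - g x).
Proof. by move=> hf hg; apply: holD => //; apply: holN. Qed.

Lemma hol_sum (I : Type) (s : seq I) (P : pred I) (F : I -> V -> C) :
  (forall i, P i -> holomorphic0 (F i)) -> holomorphic0 (fun x => \sum_(i <- s | P i) F i x).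
Proof.
move=> H; elim: s => [|i s IH].
  by apply: near_eq_holomorphic0 (hol_cst 0); near=> x; rewrite big_nil.
case: (boolP (P i)) => Pi.
  by apply: near_eq_holomorphic0 (holD (H i Pi) IH); near=> x; rewrite big_cons Pi.
by apply: near_eq_holomorphic0 IH; near=> x; rewrite big_cons (negbTE Pi).
Unshelve. all: by end_near. Qed.

Lemma hol_prod (I : Type) (s : seq I) (P : pred I) (F : I -> V -> C) :
  (forall i, P i -> holomorphic0 (F i)) -> holomorphic0 (fun x => \prod_(i <- s | P i) F i x).
Proof.
move=> H; elim: s => [|i s IH].
  by apply: near_eq_holomorphic0 (hol_cst 1); near=> x; rewrite big_nil.
case: (boolP (P i)) => Pi.
  by apply: near_eq_holomorphic0 (holM (H i Pi) IH); near=> x; rewrite big_cons Pi.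
by apply: near_eq_holomorphic0 IH; near=> x; rewrite big_cons (negbTE Pi).
Unshelve. all: by end_near. Qed.

(** [ideal_near] makes [J] a set of germs: it contains all representatives of its elements. *)
Record is_ideal J : Prop := IsIdeal {
  ideal_hol : forall f, J f -> holomorphic0 f;
  ideal_near : forall f g, (\forall x \near (0 : V), f x = g x) -> J f -> J g;
  ideal0 : J (fun _ => 0);
  idealD : forall f g, J f -> J g -> J (fun x => f x + g x);
  idealM : forall h f, holomorphic0 h -> J f -> J (fun x => h x * f x) }.

Lemma ideal_eq J f g : is_ideal J -> (forall x, f x = g x) -> J f -> J g.
Proof. by move=> iJ fg; apply: ideal_near => //; near=> x; apply: fg. Unshelve. all: by end_near. Qed.

Lemma idealN J f : is_ideal J -> J f -> J (fun x => - f x).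
Proof.
move=> iJ Jf; apply: (ideal_eq iJ _ (idealM iJ (hol_cst (-1)) Jf)) => x.
by rewrite mulN1r.
Qed.

Lemma idealB J f g : is_ideal J -> J f -> J g -> J (fun x => f x - g x).
Proof. by move=> iJ Jf Jg; apply: (idealD iJ) => //; apply: idealN. Qed.

Lemma idealMr J f h : is_ideal J -> holomorphic0 h -> J f -> J (fun x => f x * h x).
Proof. by move=> iJ hh Jf; apply: (ideal_eq iJ _ (idealM iJ hh Jf)) => x; rewrite mulrC. Qed.

Lemma ideal_sum J (I : Type) (s : seq I) (P : pred I) (F : I -> V -> C) : is_ideal J ->
  (forall i, P i -> J (F i)) -> J (fun x => \sum_(i <- s | P i) F i x).
Proof.
move=> iJ H; elim: s => [|i s IH].
  by apply: (ideal_eq iJ _ (ideal0 iJ)) => x; rewrite big_nil.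
case: (boolP (P i)) => Pi.
  by apply: (ideal_eq iJ _ (idealD iJ (H i Pi) IH)) => x; rewrite big_cons Pi.
by apply: (ideal_eq iJ _ IH) => x; rewrite big_cons (negbTE Pi).
Qed.

Lemma ideal_gen_ideal S : is_ideal (ideal_gen S).
Proof.
split.
- by move=> f [].
- move=> f g fg [hf [k [h [s [hh hs E]]]]]; split; first exact: near_eq_holomorphic0 hf.
  exists k, h, s; split => //; near=> x.
  have <- : f x = g x by near: x.
  by near: x.
- split; first exact: hol_cst.
  exists 0%N, (fun _ _ => 0), (fun _ _ => 0); split; try by case.
  by near=> x; rewrite big_ord0.
- move=> f g [hf [k [h [s [hh hs E]]]]] [hg [k' [h' [s' [hh' hs' E']]]]].
  split; first exact: holD.
  exists (k + k')%N, (fun i => match fintype.split i with inl j => h j | inr j => h' j end),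
    (fun i => match fintype.split i with inl j => s j | inr j => s' j end); split.
  + by move=> i; case: fintype.split.
  + by move=> i; case: fintype.split.
  near=> x; rewrite big_split_ord /=; congr (_ + _).
    rewrite [LHS](_ : _ = \sum_(i < k) h i x * s i x); last by near: x.
    by apply: eq_bigr => i _; rewrite (unsplitK (inl i)).
  rewrite [LHS](_ : _ = \sum_(i < k') h' i x * s' i x); last by near: x.
  by apply: eq_bigr => i _; rewrite (unsplitK (inr i)).
- move=> a f ha [hf [k [h [s [hh hs E]]]]]; split; first exact: holM.
  exists k, (fun i x => a x * h i x), s; split => //; first by move=> i; apply: holM.
  near=> x; rewrite [f x](_ : _ = \sum_(i < k) h i x * s i x); last by near: x.
  by rewrite mulr_sumr; apply: eq_bigr => i _; rewrite mulrA.
Unshelve. all: by end_near. Qed.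

Lemma mem_ideal_gen S f : holomorphic0 f -> S f -> ideal_gen S f.
Proof.
move=> hf Sf; split => //; exists 1%N, (fun _ _ => 1), (fun _ => f); split => //.
  by move=> _; apply: hol_cst.
by near=> x; rewrite big_ord1 mul1r.
Unshelve. all: by end_near. Qed.

Lemma ideal_gen_sub S J : is_ideal J -> S `<=` J -> ideal_gen S `<=` J.
Proof.
move=> iJ SJ f [hf [k [h [s [hh hs E]]]]].
apply: (ideal_near iJ (f := fun x => \sum_(i < k) h i x * s i x)).
  by near=> x; apply/esym; near: x.
by apply: ideal_sum => // i _; apply: idealM => //; apply: SJ.
Unshelve. all: by end_near. Qed.

(** Common ground for the partial derivatives and for the vector fields [tangent i] with variable
    coefficients; [deriv_near] makes [D] act on germs. *)
Record is_derivation (D : (V -> C) -> V -> C) : Prop := IsDerivation {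
  deriv_cst : forall a x, D (fun _ => a) x = 0;
  derivD : forall f g x, differentiable f x -> differentiable g x ->
    D (fun y => f y + g y) x = D f x + D g x;
  derivM : forall f g x, differentiable f x -> differentiable g x ->
    D (fun y => f y * g y) x = D f x * g x + f x * D g x;
  deriv_near : forall f g, (\forall x \near (0 : V), f x = g x) ->
    \forall x \near (0 : V), D f x = D g x }.

Lemma diff_sum (I : Type) (s : seq I) (P : pred I) (F : I -> V -> C) x :
  (forall i, P i -> differentiable (F i) x) ->
  differentiable (fun y => \sum_(i <- s | P i) F i y) x.
Proof.
move=> H; elim: s => [|i s IH].
  rewrite (_ : (fun _ => _) = fun _ => 0); first exact: differentiable_cst.
  by apply/funext => y; rewrite big_nil.
case: (boolP (P i)) => Pi.
  rewrite (_ : (fun _ => _) = fun y => F i y + \sum_(i <- s | P i) F i y).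
    by apply: differentiableD => //; apply: H.
  by apply/funext => y; rewrite big_cons Pi.
rewrite (_ : (fun _ => _) = fun y => \sum_(i <- s | P i) F i y) //.
by apply/funext => y; rewrite big_cons (negbTE Pi).
Qed.

Lemma deriv_sum D (I : Type) (s : seq I) (P : pred I) (F : I -> V -> C) x : is_derivation D ->
  (forall i, P i -> differentiable (F i) x) ->
  D (fun y => \sum_(i <- s | P i) F i y) x = \sum_(i <- s | P i) D (F i) x.
Proof.
move=> dD H; elim: s => [|i s IH].
  rewrite big_nil (_ : (fun _ => _) = fun _ => 0) ?(deriv_cst dD) //.
  by apply/funext => y; rewrite big_nil.
rewrite big_cons -IH; case: (boolP (P i)) => Pi.
  rewrite -(derivD dD); [|exact: H|exact: diff_sum].
  by congr (D _ x); apply/funext => y; rewrite big_cons Pi.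
by congr (D _ x); apply/funext => y; rewrite big_cons (negbTE Pi).
Qed.

(** By the Leibniz rule, D (sum h_i s_i) is the sum of the D h_i s_i + h_i D s_i, so it suffices to
    control s_i and D s_i on generators. *)
Lemma deriv_ideal D S J : is_derivation D -> is_ideal J ->
  (forall f, holomorphic0 f -> holomorphic0 (D f)) ->
  (forall f, S f -> [/\ holomorphic0 f, J f & J (D f)]) ->
  forall f, ideal_gen S f -> J (D f).
Proof.
move=> dD iJ hD SJ f [hf [k [h [s [hh hs E]]]]].
pose F x := \sum_(i < k) (D (h i) x * s i x + h i x * D (s i) x).
apply: (ideal_near iJ (f := F)); last first.
  apply: ideal_sum => // i _; have [h1 h2 h3] := SJ _ (hs i).
  by apply: (idealD iJ); apply: (idealM iJ) => //; apply: hD.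
have Ds i : holomorphic0 (s i) by have [] := SJ _ (hs i).
have Dall : \forall x \near (0 : V), forall i, differentiable (h i) x /\ differentiable (s i) x.
  refine (@filter_forall V 'I_k (fun i x =>
    differentiable (h i) x /\ differentiable (s i) x) (nbhs (0 : V)) _ _); move=> i.
  near=> x; split; near: x; [exact: hh|exact: Ds].
have DE := deriv_near dD E.
near=> x.
have -> : D f x = D (fun x => \sum_(i < k) h i x * s i x) x by near: x.
have dx : forall i, differentiable (h i) x /\ differentiable (s i) x by near: x.
rewrite (deriv_sum _ dD) => [|i _].
  by apply: eq_bigr => i _; rewrite (derivM dD) //; case: (dx i).
by apply: differentiableM; case: (dx i).
Unshelve. all: by end_near. Qed.

Lemma partial_derivation k : is_derivation (@partial C m k).
Proof.
split.
- by move=> a x; rewrite /partial derive_cst.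
- by move=> f g x df dg; rewrite /partial (@deriveD _ _ _ f g) //; apply: diff_derivable.
- move=> f g x df dg; rewrite /partial (@deriveM _ _ f g); try exact: diff_derivable.
  by rewrite /GRing.scale /= addrC mulrC.
- move=> f g /near_join fg; near=> x; apply: near_eq_derive.
  by near: x.
Unshelve. all: by end_near. Qed.

Lemma coord_differentiable k x : differentiable (@coord C m k) x.
Proof.
rewrite /coord; case: insubP => [i _ _|_]; last exact: differentiable_cst.
exact: differentiable_coord.
Qed.

Lemma partial_coord k l x : (l < m)%N -> partial k (@coord C m l) x = (k == l)%:R.
Proof.
move=> lm; rewrite /partial deriveE; last exact: coord_differentiable.
have -> : @coord C m l = fun y : V => y 0 (Ordinal lm) by apply/funext => y; rewrite /coord insubT.
have @c : {linear V -> C}.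
  by exists (fun y : V => y 0 (Ordinal lm)); do 2![eexists]; do ?[constructor];
     rewrite ?mxE// => ? *; rewrite ?mxE//; move=> ?; rewrite !mxE.
rewrite (_ : (fun _ => _) = c) // diff_lin; last exact: coord_continuous.
by rewrite /= mxE eq_sym.
Qed.

End Ideals.

(** * Expansion of f / g^t at infinity *)

Section Expansion.
Variables (C : numFieldType) (n r : nat).
Local Notation V := ('rV[C]_(n + r)).
Local Notation dd := (@dd C n r).

Lemma coef_poly_f p (x : V) : (poly_f x)`_p = if (p < n)%N then ca p x else (p == n)%:R.
Proof.
rewrite coefD coefXn coef_poly; case: ltnP => h; last by rewrite addr0.
by rewrite (ltn_eqF h) add0r.
Qed.

Lemma coef_poly_g p (x : V) : (poly_g x)`_p = if (p < r)%N then cb p x else (p == r)%:R.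
Proof.
rewrite coefD coefXn coef_poly; case: ltnP => h; last by rewrite addr0.
by rewrite (ltn_eqF h) add0r.
Qed.

(* [grev k] is the coefficient of [y^k] in [y^r g(1/y)]. *)
Definition grev (k : nat) (x : V) : C := if (k <= r)%N then (poly_g x)`_(r - k) else 0.

(** Power series division of sum u_j y^j by sum grev_k y^k. Every coefficient needs all the earlier
    ones, so the recursion carries them in a list, the latest first. *)
Fixpoint quo_seq (u : nat -> V -> C) (j : nat) : seq (V -> C) :=
  if j is j'.+1 then
    (fun x => u j x - \sum_(k < j) grev k.+1 x * nth (fun _ => 0) (quo_seq u j') k x)
      :: quo_seq u j'
  else [:: u 0%N].

Definition quo (u : nat -> V -> C) (j : nat) : V -> C := head (fun _ => 0) (quo_seq u j).

Lemma nth_quo_seq u j k : (k <= j)%N ->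
  nth (fun _ => 0) (quo_seq u j) k = quo u (j - k).
Proof.
elim: j k => [|j IH] [|k] //; rewrite ltnS => kj.
by rewrite subSS -IH.
Qed.

Lemma quo_rec u j x :
  quo u j x = u j x - \sum_(k < j) grev k.+1 x * quo u (j - k.+1) x.
Proof.
case: j => [|j]; first by rewrite big_ord0 subr0.
congr (_ - _); apply: eq_bigr => k _; congr (_ * _).
by rewrite nth_quo_seq ?subSS // -ltnS.
Qed.

(* [quo_coef t j] is the coefficient of [x^(n - t r - j)] in the expansion of [f / g^t] at infinity. *)
Definition quo_coef (t : nat) : nat -> V -> C :=
  iter t quo (fun j x => if (j <= n)%N then (poly_f x)`_(n - j) else 0).

Arguments quo_coef : simpl never.

Lemma quo_coef0 j x : quo_coef 0 j x = if (j <= n)%N then (poly_f x)`_(n - j) else 0.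
Proof. by []. Qed.

Lemma quo_coef_rec t j x :
  quo_coef t.+1 j x = quo_coef t j x - \sum_(k < j) grev k.+1 x * quo_coef t.+1 (j - k.+1) x.
Proof. exact: quo_rec. Qed.

Lemma grev_cb k x : (0 < k <= r)%N -> grev k x = cb (r - k) x.
Proof. by move=> /andP[k0 kr]; rewrite /grev kr coef_poly_g; case: ltnP => //; lia. Qed.

Lemma grev_big k x : (r < k)%N -> grev k x = 0.
Proof. by move=> h; rewrite /grev leqNgt h. Qed.

(** The recursion for d is long division by g, so d_i is the coefficient of x^(i - r) in f/g. Its
    truncation at r matches the vanishing of [grev] beyond r. *)
Lemma dd_quo_coef j x : (j <= n)%N -> dd (n - j) x = quo_coef 1 j x.
Proof.
elim/ltn_ind: j => -[|j] IH jn.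
  by rewrite subn0 dd_n quo_coef_rec big_ord0 subr0 quo_coef0 /= subn0 coef_poly_f ltnn eqxx.
rewrite dd_rec ?jn // quo_coef_rec quo_coef0 jn coef_poly_f; case: ltnP => [_|]; last by lia.
congr (_ - _); rewrite big_add1 /= big_mkord.
rewrite (big_ord_widen j.+1 (fun k => cb (r - k.+1) x * dd (n - j.+1 + k.+1) x)) ?geq_minl //.
rewrite big_mkcond; apply: eq_bigr => k _; case: ifP => kr.
  by rewrite grev_cb ?(leq_trans kr) ?geq_minr // -IH; [congr (_ * dd _ x); lia|lia|lia].
by rewrite grev_big ?mul0r //; have := ltn_ord k; lia.
Qed.

Lemma grev_diff k x : differentiable (grev k) x.
Proof.
have [k0|k0] := posnP k.
  rewrite (_ : grev k = fun _ => 1); first exact: differentiable_cst.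
  by apply/funext => y; rewrite /grev k0 subn0 coef_poly_g ltnn eqxx.
have [kr|kr] := leqP k r.
  rewrite (_ : grev k = cb (r - k)); first exact: coord_differentiable.
  by apply/funext => y; rewrite grev_cb // k0.
rewrite (_ : grev k = fun _ => 0); first exact: differentiable_cst.
by apply/funext => y; rewrite grev_big.
Qed.

Lemma coef_poly_f_diff p x : differentiable (fun y : V => (poly_f y)`_p) x.
Proof.
have [h|h] := ltnP p n.
  rewrite (_ : (fun _ => _) = ca p); first exact: coord_differentiable.
  by apply/funext => y; rewrite coef_poly_f h.
rewrite (_ : (fun _ => _) = fun _ => (p == n)%:R); first exact: differentiable_cst.
by apply/funext => y; rewrite coef_poly_f ltnNge h.
Qed.

Lemma coef_poly_g_diff p x : differentiable (fun y : V => (poly_g y)`_p) x.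
Proof.
have [h|h] := ltnP p r.
  rewrite (_ : (fun _ => _) = cb p); first exact: coord_differentiable.
  by apply/funext => y; rewrite coef_poly_g h.
rewrite (_ : (fun _ => _) = fun _ => (p == r)%:R); first exact: differentiable_cst.
by apply/funext => y; rewrite coef_poly_g ltnNge h.
Qed.

Lemma quo_coef_diff t j x : differentiable (quo_coef t j) x.
Proof.
elim: t j => [|t IHt] j.
  have [h|h] := leqP j n.
    rewrite (_ : quo_coef 0 j = fun y => (poly_f y)`_(n - j)); first exact: coef_poly_f_diff.
    by apply/funext => y; rewrite quo_coef0 h.
  rewrite (_ : quo_coef 0 j = fun _ => 0); first exact: differentiable_cst.
  by apply/funext => y; rewrite quo_coef0 leqNgt h.
elim/ltn_ind: j => j IH.
rewrite (_ : quo_coef t.+1 j = fun y => quo_coef t j y - \sum_(k < j) grev k.+1 y * quo_coef t.+1 (j - k.+1) y).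
  apply: differentiableB => //; apply: diff_sum => k _.
  apply: differentiableM; first exact: grev_diff.
  by apply: IH; have := ltn_ord k; lia.
by apply/funext => y; rewrite quo_coef_rec.
Qed.

(** The coefficients of the series multiplied by y^i; the test guards against truncated
    subtraction. *)
Definition quo_coef_shift t j i x := if (i <= j)%N then quo_coef t (j - i) x else 0.

Lemma quo_coef_shift_rec t j i x : quo_coef_shift t.+1 j i x =
  quo_coef_shift t j i x - \sum_(k < j) grev k.+1 x * quo_coef_shift t.+1 (j - k.+1) i x.
Proof.
rewrite /quo_coef_shift; case: leqP => ij; last first.
  rewrite big1 ?subr0 // => k _; case: leqP; rewrite ?mulr0 //; lia.
rewrite quo_coef_rec; congr (_ - _).
rewrite (big_ord_widen j (fun k => grev k.+1 x * quo_coef t.+1 (j - i - k.+1) x)) ?leq_subr //.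
rewrite big_mkcond; apply: eq_bigr => k _; have hk := ltn_ord k.
case: ifP => h1.
  have -> : (i <= j - k.+1)%N by lia.
  by congr (_ * quo_coef _ _ _); lia.
by rewrite (_ : (i <= j - k.+1)%N = false) ?mulr0 //; lia.
Qed.

Lemma sum_quo_coef_shift t j i x : (0 < i)%N ->
  \sum_(k < j) (k.+1 == i)%:R * quo_coef t (j - k.+1) x = quo_coef_shift t j i x.
Proof.
case: i => // i _; rewrite /quo_coef_shift; case: ltnP => ij.
  rewrite (bigD1 (Ordinal ij)) //= eqxx mul1r big1 ?addr0 // => k /eqP nk.
  case: eqP => [[ki]|_]; last by rewrite mul0r.
  by case: nk; apply: val_inj.
rewrite big1 // => k _; case: eqP => [[ki]|_]; last by rewrite mul0r.
by have := ltn_ord k; lia.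
Qed.

Lemma deriv_sub (D : (V -> C) -> V -> C) (f g : V -> C) x : is_derivation D ->
  differentiable f x -> differentiable g x ->
  D (fun y => f y - g y) x = D f x - D g x.
Proof.
move=> dD df dg; apply/eqP; rewrite eq_sym subr_eq -(derivD dD) //; last exact: differentiableB.
by apply/eqP; congr (D _ x); apply/funext => y; rewrite subrK.
Qed.

(* If [D] sends [g] to [x^l] and [f] to [- c x^l f / g] modulo [P], then it sends
   [f / g^t] to [- (c + t) x^l f / g^(t+1)] modulo [P], where [i = r - l]. *)
Lemma deriv_quo_coef (D : (V -> C) -> V -> C) (P : set (V -> C)) (i : nat) (c : C) :
  is_derivation D ->
  (forall f g, (forall x, f x = g x) -> P f -> P g) ->
  (forall f g, P f -> P g -> P (fun x => f x - g x)) ->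
  (forall I (s : seq I) (F : I -> V -> C), (forall i, P (F i)) -> P (fun x => \sum_(i <- s) F i x)) ->
  (forall k f, P f -> P (fun x => grev k x * f x)) ->
  (0 < i)%N -> (forall k x, (0 < k)%N -> D (grev k) x = (k == i)%:R) ->
  (forall j, P (fun x => D (quo_coef 0 j) x + c * quo_coef_shift 1 j i x)) ->
  forall t j, P (fun x => D (quo_coef t j) x + (c + t%:R) * quo_coef_shift t.+1 j i x).
Proof.
move=> dD Peq PB Ps PM i0 Dg H0; elim=> [|t IHt] j.
  by apply: Peq (H0 j) => x; rewrite addr0.
elim/ltn_ind: j => j IH.
(* The claim for j is the claim for t minus these multiples of the claims for smaller indices, by
   the recursion of [quo_coef] and the Leibniz rule. *)
pose F (k : 'I_j) x := grev k.+1 x *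
  (D (quo_coef t.+1 (j - k.+1)) x + (c + t.+1%:R) * quo_coef_shift t.+2 (j - k.+1) i x).
apply: Peq (PB _ _ (IHt j) (Ps _ (index_enum _) F _)); last first.
  by move=> k; apply: PM; apply: IH; have := ltn_ord k; lia.
move=> x.
have -> : D (quo_coef t.+1 j) x = D (quo_coef t j) x -
    \sum_(k < j) (grev k.+1 x * D (quo_coef t.+1 (j - k.+1)) x) - quo_coef_shift t.+1 j i x.
  rewrite -(sum_quo_coef_shift _ _ _ i0) -addrA -opprD -big_split /=.
  have -> : quo_coef t.+1 j = fun y => quo_coef t j y - \sum_(k < j) grev k.+1 y * quo_coef t.+1 (j - k.+1) y.
    by apply/funext => y; rewrite quo_coef_rec.
  have dm (k : 'I_j) : differentiable (fun y => grev k.+1 y * quo_coef t.+1 (j - k.+1) y) x.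
    by apply: differentiableM; [apply: grev_diff|apply: quo_coef_diff].
  rewrite deriv_sub //; last by apply: diff_sum => k _; apply: dm.
    rewrite (deriv_sum _ dD); last by move=> k _; apply: dm.
    congr (_ - _); apply: eq_bigr => k _.
    rewrite (derivM dD (grev_diff _ _) (quo_coef_diff _ _ _)) Dg //; exact: addrC.
  exact: quo_coef_diff.
rewrite (quo_coef_shift_rec t.+1) /F.
under eq_bigr do rewrite mulrDr mulrCA.
rewrite big_split /= -mulr_sumr -natr1.
move: (\sum_(k < j) _) (\sum_(k < j) _) => a b; ring.
Qed.
End Expansion.
Arguments quo_coef : simpl never.

(** * The vector fields [tangent i] and their action on f g and f / g^t *)

Section Tangent.
Variables (C : numFieldType) (n r : nat).
Hypotheses (r_gt0 : (0 < r)%N) (le_rn : (r <= n)%N).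
Local Notation V := ('rV[C]_(n + r)).
Local Notation dd := (@dd C n r).
Local Notation cc := (@cc C n r).
Local Notation quo_coef := (@quo_coef C n r).
Implicit Types (F G : V -> C).

Lemma dd_diff i x : (i <= n)%N -> differentiable (dd i) x.
Proof.
move=> hi; rewrite (_ : dd i = quo_coef 1 (n - i)); first exact: quo_coef_diff.
by apply/funext => y; rewrite -dd_quo_coef ?leq_subr // subKn.
Qed.

Lemma partial_coef_f k p (x : V) : (k < n)%N ->
  partial k (fun y : V => (poly_f y)`_p) x = (k == p)%:R.
Proof.
move=> kn; have [pn|pn] := ltnP p n.
  rewrite (_ : (fun _ => _) = ca p); last by apply/funext => y; rewrite coef_poly_f pn.
  by rewrite partial_coord // ltn_addr.
rewrite (_ : (fun _ => _) = fun _ => (p == n)%:R); last first.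
  by apply/funext => y; rewrite coef_poly_f ltnNge pn.
rewrite (deriv_cst (partial_derivation _ _ _)); case: eqP => // kp; lia.
Qed.

Lemma partial_coef_g k p (x : V) : (k < n)%N ->
  partial k (fun y : V => (poly_g y)`_p) x = 0.
Proof.
move=> kn; have [pn|pn] := ltnP p r.
  rewrite (_ : (fun _ => _) = cb p); last by apply/funext => y; rewrite coef_poly_g pn.
  by rewrite partial_coord ?ltn_add2l //; case: eqP => // kp; lia.
rewrite (_ : (fun _ => _) = fun _ => (p == r)%:R); last first.
  by apply/funext => y; rewrite coef_poly_g ltnNge pn.
by rewrite (deriv_cst (partial_derivation _ _ _)).
Qed.

Lemma partial_b_coef_f k p (x : V) :
  partial (n + k) (fun y : V => (poly_f y)`_p) x = 0.
Proof.
have [pn|pn] := ltnP p n.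
  rewrite (_ : (fun _ => _) = ca p); last by apply/funext => y; rewrite coef_poly_f pn.
  by rewrite partial_coord ?ltn_addr //; case: eqP => // kp; lia.
rewrite (_ : (fun _ => _) = fun _ => (p == n)%:R); last first.
  by apply/funext => y; rewrite coef_poly_f ltnNge pn.
by rewrite (deriv_cst (partial_derivation _ _ _)).
Qed.

Lemma partial_b_coef_g k p (x : V) : (k < r)%N ->
  partial (n + k) (fun y : V => (poly_g y)`_p) x = (k == p)%:R.
Proof.
move=> kn; have [pn|pn] := ltnP p r.
  rewrite (_ : (fun _ => _) = cb p); last by apply/funext => y; rewrite coef_poly_g pn.
  by rewrite partial_coord ?ltn_add2l // eqn_add2l.
rewrite (_ : (fun _ => _) = fun _ => (p == r)%:R); last first.
  by apply/funext => y; rewrite coef_poly_g ltnNge pn.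
by rewrite (deriv_cst (partial_derivation _ _ _)); case: eqP => // kp; lia.
Qed.

Lemma ccE j : cc j = fun x => \sum_(i < j.+1) (poly_f x)`_i * (poly_g x)`_(j - i).
Proof. by apply/funext => x; rewrite /Defs.cc coefM. Qed.

Lemma cc_diff j x : differentiable (cc j) x.
Proof.
rewrite ccE; apply: diff_sum => i _; apply: differentiableM.
  exact: coef_poly_f_diff.
exact: coef_poly_g_diff.
Qed.

Lemma deriv_cc D j (x : V) : is_derivation D -> D (cc j) x =
  \sum_(i < j.+1) (D (fun y => (poly_f y)`_i) x * (poly_g x)`_(j - i) +
                   (poly_f x)`_i * D (fun y => (poly_g y)`_(j - i)) x).
Proof.
move=> dD; rewrite ccE (deriv_sum _ dD).
  apply: eq_bigr => i _; rewrite (derivM dD) //; first exact: coef_poly_f_diff.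
  exact: coef_poly_g_diff.
move=> i _; apply: differentiableM; first exact: coef_poly_f_diff.
exact: coef_poly_g_diff.
Qed.

Lemma partial_a_cc k j (x : V) : (k < n)%N -> partial k (cc j) x = ('X^k * poly_g x)`_j.
Proof.
move=> kn; rewrite (deriv_cc _ _ (partial_derivation _ _ _)) coefXnM.
under eq_bigr do rewrite partial_coef_f // partial_coef_g // mulr0 addr0.
case: ltnP => h.
  by rewrite big1 // => i _; case: eqP => [e|]; rewrite ?mul0r //; have := ltn_ord i; lia.
rewrite (bigD1 (Ordinal (h : (k < j.+1)%N))) //= eqxx mul1r big1 ?addr0 // => i /eqP ni.
by case: eqP => [e|_]; [case: ni; apply: val_inj|rewrite mul0r].
Qed.

Lemma partial_b_cc k j (x : V) : (k < r)%N -> partial (n + k) (cc j) x = ('X^k * poly_f x)`_j.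
Proof.
move=> kn; rewrite (deriv_cc _ _ (partial_derivation _ _ _)) coefXnM.
under eq_bigr do rewrite partial_b_coef_f // partial_b_coef_g // mul0r add0r.
case: ltnP => h.
  by rewrite big1 // => i _; case: eqP => [e|]; rewrite ?mulr0 //; have := ltn_ord i; lia.
have hj : (j - k < j.+1)%N by lia.
rewrite (bigD1 (Ordinal hj)) //= subKn // eqxx mulr1 big1 ?addr0 // => i /eqP ni.
case: eqP => [e|_]; last by rewrite mulr0.
by case: ni; apply: val_inj => /=; have := ltn_ord i; lia.
Qed.

(* Modulo the ideal of the remainder of [f] by [g], these vector fields are tangent to the
   fibres of [(f, g) |-> f g]: they add [- x^i f / g] to [f] and [x^i] to [g]. *)
Definition tangent (i : nat) (F : V -> C) (x : V) : C :=
  partial (n + i) F x - \sum_(k < (n - r).+1) dd (r + k) x * partial (i + k) F x.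

Lemma tangent_derivation i : is_derivation (tangent i).
Proof.
have dP k := @partial_derivation C (n + r) k.
split.
- move=> a x; rewrite /tangent (deriv_cst (dP _)) big1 ?subr0 // => k _.
  by rewrite (deriv_cst (dP _)) mulr0.
- move=> F G x dF dG; rewrite /tangent (derivD (dP _)) //.
  under eq_bigr do rewrite (derivD (dP _)) // mulrDr.
  by rewrite big_split /= opprD addrACA.
- move=> F G x dF dG; rewrite /tangent (derivM (dP _)) //.
  under eq_bigr do rewrite (derivM (dP _)) // mulrDr mulrA (mulrCA _ (F x)).
  rewrite big_split /= -mulr_suml -mulr_sumr.
  by move: (\sum_(k < _) _) (\sum_(k < _) _) => a b; ring.
- move=> F G FG.
  have H k := deriv_near (dP k) FG.
  have Hall : \forall x \near (0 : V), forall k : 'I_(n - r).+1,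
      partial (i + k) F x = partial (i + k) G x.
    refine (@filter_forall V _ (fun (k : 'I_(n - r).+1) x =>
      partial (i + k) F x = partial (i + k) G x) (nbhs (0 : V)) _ _).
    by move=> k; apply: H.
  near=> x; rewrite /tangent.
  have -> : partial (n + i) F x = partial (n + i) G x by near: x; apply: H.
  congr (_ - _); apply: eq_bigr => k _; congr (_ * _).
  have Hx : forall k : 'I_(n - r).+1, partial (i + k) F x = partial (i + k) G x by near: x.
  exact: Hx.
Unshelve. all: by end_near. Qed.

(** The polynomial part of f/g, as d_(r+k) is its coefficient of x^k; [coef_rem_poly_big] shows that
    this is Euclidean division. *)
Definition quot_poly (x : V) : {poly C} := \poly_(k < (n - r).+1) dd (r + k) x.
Definition rem_poly (x : V) : {poly C} := poly_f x - quot_poly x * poly_g x.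

(** The field adds x^i to g and subtracts x^i times the quotient q from f, so f g changes by x^i (f
    - q g). *)
Lemma tangent_cc i j (x : V) : (i < r)%N -> tangent i (cc j) x = ('X^i * rem_poly x)`_j.
Proof.
move=> ir; rewrite /tangent partial_b_cc // /rem_poly mulrBr coefB; congr (_ - _).
rewrite /quot_poly poly_def mulrA mulr_sumr mulr_suml coef_sum.
apply: eq_bigr => k _; have := ltn_ord k => hk.
rewrite partial_a_cc; last by lia.
by rewrite -scalerAr -scalerAl coefZ exprD.
Qed.

(** The remainder is g times the part of f/g with negative powers of x; in degree p >= 0 only the
    coefficients d_l with l < r meet a coefficient of g. *)
Lemma coef_rem_poly p (x : V) :
  (rem_poly x)`_p = \sum_(l < r) dd l x * (poly_g x)`_(r + p - l).
Proof.
(* Truncated subtraction gives [dd l] the value 1 beyond n, where the series has coefficient 0. *)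
pose D l := if (l <= n)%N then dd l x else 0.
(* This is g (f/g) = f. The powers of f/g below x^(-r) would need coefficients of g beyond degree
   r. *)
have fD : (poly_f x)`_p = \sum_(l < r + p.+1) D l * (poly_g x)`_(r + p - l).
  have [pn|np] := leqP p n; last first.
    rewrite coef_poly_f ltnNge (ltnW np) /= gtn_eqF // big1 // => l _.
    rewrite /D; case: leqP => ln; last by rewrite mul0r.
    rewrite coef_poly_g; case: ltnP => h; first by lia.
    by rewrite gtn_eqF ?mulr0 //; lia.
  have -> : (poly_f x)`_p = quo_coef 0 (n - p) x by rewrite quo_coef0 leq_subr subKn.
  have -> : quo_coef 0 (n - p) x = \sum_(k < (n - p).+1) grev k x * quo_coef 1 (n - p - k) x.
    rewrite big_ord_recl quo_coef_rec /= subn0 /grev leq0n subn0 coef_poly_g ltnn eqxx mul1r.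
    by rewrite subrK.
  have -> : (r + p.+1 = p + r.+1)%N by lia.
  rewrite big_split_ord /= [X in _ = X + _]big1 ?add0r; last first.
    move=> l _; rewrite coef_poly_g; have := ltn_ord l => hl; case: ltnP => h; first by lia.
    by rewrite gtn_eqF ?mulr0 //; lia.
  rewrite (big_ord_widen (n + r).+1 (fun k => grev k x * quo_coef 1 (n - p - k) x)); last by lia.
  rewrite (big_ord_widen (n + r).+1 (fun k => D (p + k)%N * (poly_g x)`_(r + p - (p + k)))); last by lia.
  rewrite !(big_mkcond (fun k : 'I_(n + r).+1 => (k < _)%N)) /=.
  apply: eq_bigr => k _; rewrite /D /grev !ltnS.
  case: (leqP k r) => kr; last by rewrite mul0r; case: ifP.
  have -> : (k <= n - p)%N = (p + k <= n)%N by lia.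
  case: leqP => pk; last by rewrite mul0r.
  rewrite mulrC -dd_quo_coef; last by lia.
  by congr (dd _ x * _`__); lia.
rewrite /rem_poly coefB fD big_split_ord /= coefM /quot_poly.
rewrite [X in _ + X - _](_ : _ = \sum_(j < p.+1) (\poly_(k < (n - r).+1) dd (r + k) x)`_j * (poly_g x)`_(p - j)).
  by rewrite addrK; apply: eq_bigr => l _; rewrite /D (leq_trans (ltnW (ltn_ord l)) le_rn).
apply: eq_bigr => l _; rewrite coef_poly /D subnDl.
by have -> : (l < (n - r).+1)%N = (r + l <= n)%N by lia.
Qed.

Lemma coef_rem_poly_big p (x : V) : (r <= p)%N -> (rem_poly x)`_p = 0.
Proof.
move=> rp; rewrite coef_rem_poly big1 // => l _; have := ltn_ord l => hl.
rewrite coef_poly_g; case: ltnP => h; first by lia.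
by rewrite gtn_eqF ?mulr0 //; lia.
Qed.

Lemma partial_grev i k (x : V) : (i < r)%N -> (0 < k)%N ->
  partial (n + i) (@grev C n r k) x = (k == r - i)%N%:R.
Proof.
move=> ir k0; have [kr|kr] := leqP k r.
  rewrite (_ : grev k = fun y => (poly_g y)`_(r - k)); last first.
    by apply/funext => y; rewrite /grev kr.
  by rewrite partial_b_coef_g //; congr (_ %:R); lia.
rewrite (_ : grev k = fun _ => 0); last by apply/funext => y; rewrite grev_big.
by rewrite (deriv_cst (partial_derivation _ _ _)); case: eqP => //; lia.
Qed.

Lemma tangent_grev i k (x : V) : (i < r)%N -> (0 < k)%N ->
  tangent i (@grev C n r k) x = (k == r - i)%N%:R.
Proof.
move=> ir k0; rewrite /tangent partial_grev // big1 ?subr0 // => l _.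
have := ltn_ord l => hl; have [kr|kr] := leqP k r.
  rewrite (_ : grev k = fun y => (poly_g y)`_(r - k)); last first.
    by apply/funext => y; rewrite /grev kr.
  by rewrite partial_coef_g ?mulr0 //; lia.
rewrite (_ : grev k = fun _ => 0); last by apply/funext => y; rewrite grev_big.
by rewrite (deriv_cst (partial_derivation _ _ _)) mulr0.
Qed.

Lemma partial_quo_coef i t j (x : V) : (i < r)%N ->
  partial (n + i) (quo_coef t j) x = - (t%:R * quo_coef_shift t.+1 j (r - i) x).
Proof.
move=> ir; apply/eqP; rewrite -addr_eq0; apply/eqP.
rewrite -[t%:R]add0r.
(* For [P] the functions vanishing everywhere, the congruence is an equality; c = 0 since f does not
   involve the b's. *)
apply: (@deriv_quo_coef _ _ _ (partial (n + i)) [set F | forall x, F x = 0] (r - i) 0) => //.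
- exact: partial_derivation.
- by move=> F G FG /= H y; rewrite -FG.
- by move=> F G /= HF HG y; rewrite HF HG subr0.
- by move=> I s F /= H y; rewrite big1.
- by move=> k F /= H y; rewrite H mulr0.
- by rewrite subn_gt0.
- by move=> k y k0; apply: partial_grev.
- move=> k y; rewrite mul0r addr0.
  have [h|h] := leqP k n.
    rewrite (_ : quo_coef 0 k = fun y => (poly_f y)`_(n - k)); first exact: partial_b_coef_f.
    by apply/funext => z; rewrite quo_coef0 h.
  rewrite (_ : quo_coef 0 k = fun _ => 0); first by rewrite (deriv_cst (partial_derivation _ _ _)).
  by apply/funext => z; rewrite quo_coef0 leqNgt h.
Qed.

(** Modulo [J] the quotient q equals f/g, so the field sends f to - x^i f/g. This is
    [deriv_quo_coef] with c = 1. *)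
Lemma tangent_quo_coef (J : set (V -> C)) i t j : is_ideal J -> (i < r)%N ->
  (forall l, (n < l + r)%N -> J (quo_coef 1 l)) ->
  J (fun x => tangent i (quo_coef t j) x + (1 + t%:R) * quo_coef_shift t.+1 j (r - i) x).
Proof.
move=> iJ ir HJ.
apply: (deriv_quo_coef (P := J) (tangent_derivation i)).
- by move=> F G; apply: ideal_eq.
- by move=> F G; apply: idealB.
- by move=> I s F H; apply: ideal_sum.
- by move=> k F; apply: (idealM iJ); apply: hol_everywhere => x; apply: grev_diff.
- by rewrite subn_gt0.
- by move=> k y k0; apply: tangent_grev.
move=> {}j.
have [nj|jn] := ltnP n j.
  rewrite (_ : quo_coef 0 j = fun _ => 0); last by apply/funext => z; rewrite quo_coef0 leqNgt nj.
  apply: (ideal_eq iJ _ (HJ (j - (r - i))%N _)); last by lia.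
  move=> x; rewrite (deriv_cst (tangent_derivation i)) add0r mul1r /quo_coef_shift.
  by have -> : (r - i <= j)%N by lia.
have E0 : quo_coef 0 j = fun y => (poly_f y)`_(n - j) by apply/funext => z; rewrite quo_coef0 jn.
(* The coefficient of x^(n - j) in - x^i q. *)
have T x : tangent i (quo_coef 0 j) x =
    if (i <= n - j)%N && (n - j <= i + (n - r))%N then - dd (r + (n - j - i)) x else 0.
  rewrite /tangent E0 partial_b_coef_f sub0r.
  have -> : \sum_(k < (n - r).+1) dd (r + k) x * partial (i + k) (fun y : V => (poly_f y)`_(n - j)) x
     = \sum_(k < (n - r).+1) dd (r + k) x * (i + k == n - j)%N%:R.
    by apply: eq_bigr => k _; rewrite partial_coef_f //; have := ltn_ord k; lia.
  case: ifP => h.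
    have hk : (n - j - i < (n - r).+1)%N by lia.
    rewrite (bigD1 (Ordinal hk)) //= subnKC ?eqxx ?mulr1; last by lia.
    rewrite big1 ?addr0 // => k /eqP nk; case: eqP => e; last by rewrite mulr0.
    by case: nk; apply: val_inj => /=; lia.
  rewrite big1 ?oppr0 // => k _; case: eqP => e; last by rewrite mulr0.
  by have := ltn_ord k; lia.
(* Within the range of x^i q the two terms cancel exactly. Outside it, the coefficient of x^i f/g
   belongs to a negative power of f/g, hence to [J], or exceeds the degree and is 0. *)
case: (boolP ((i <= n - j) && (n - j <= i + (n - r)))%N) => h.
  apply: (ideal_eq iJ _ (ideal0 iJ)) => x; rewrite T h mul1r /quo_coef_shift.
  have -> : (r - i <= j)%N by lia.
  rewrite (_ : (r + (n - j - i) = n - (j - (r - i)))%N); last by lia.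
  by rewrite dd_quo_coef ?addNr //; lia.
have [h2|h2] := leqP (r - i) j; last first.
  apply: (ideal_eq iJ _ (ideal0 iJ)) => x; rewrite T (negbTE h) mul1r /quo_coef_shift.
  by rewrite leqNgt h2 add0r.
apply: (ideal_eq iJ _ (HJ (j - (r - i))%N _)); last by lia.
by move=> x; rewrite T (negbTE h) mul1r /quo_coef_shift h2 add0r.
Qed.

End Tangent.

(** * Minors of Jacobian matrices *)

Section DetCongruence.
Variables (C : numFieldType) (m : nat).
Local Notation V := ('rV[C]_m).

(** The product has rank at most p. *)
Lemma det_mulmx_small (k p : nat) (A : 'M[C]_(k, p)) (B : 'M[C]_(p, k)) :
  (p < k)%N -> \det (A *m B) = 0.
Proof.
move=> pk; apply/eqP; apply: contraT => d0.
have : \rank (A *m B) = k by apply: mxrank_unit; rewrite unitmxE unitfE.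
by have := leq_trans (mxrankM_maxl A B) (rank_leq_col A) => + rk; rewrite rk leqNgt pk.
Qed.

Lemma prod_cong (J : set (V -> C)) (I : Type) (s : seq I) (F G : I -> V -> C) :
  is_ideal J -> (forall i, holomorphic0 (F i)) -> (forall i, holomorphic0 (G i)) ->
  (forall i, J (fun x => F i x - G i x)) ->
  J (fun x => \prod_(i <- s) F i x - \prod_(i <- s) G i x).
Proof.
move=> iJ hF hG H; elim: s => [|i s IH].
  by apply: (ideal_eq iJ _ (ideal0 iJ)) => x; rewrite !big_nil subrr.
have h1 : holomorphic0 (fun x => \prod_(i <- s) F i x) by apply: hol_prod.
apply: (ideal_eq iJ _ (idealD iJ (idealM iJ h1 (H i)) (idealM iJ (hG i) IH))) => x.
by rewrite !big_cons; ring.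
Qed.

Lemma det_cong (J : set (V -> C)) k (X Y : 'I_k -> 'I_k -> V -> C) : is_ideal J ->
  (forall i j, holomorphic0 (X i j)) -> (forall i j, holomorphic0 (Y i j)) ->
  (forall i j, J (fun x => X i j x - Y i j x)) ->
  J (fun x => \det (\matrix_(i, j) X i j x) - \det (\matrix_(i, j) Y i j x)).
Proof.
move=> iJ hX hY H.
pose P (s : 'S_k) x := (-1) ^+ s * (\prod_i X i (s i) x - \prod_i Y i (s i) x).
apply: (ideal_eq iJ (f := fun x => \sum_(s : 'S_k) P s x)).
  move=> x; rewrite /determinant -sumrB; apply: eq_bigr => s _; rewrite /P mulrBr.
  by congr (_ * _ - _ * _); apply: eq_bigr => i _; rewrite mxE.
apply: ideal_sum => // s _; apply: (idealM iJ); first exact: hol_cst.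
by apply: (@prod_cong J _ _ (fun i => X i (s i)) (fun i => Y i (s i))).
Qed.

Lemma ideal_add_ideal (I J : set (V -> C)) : is_ideal I -> is_ideal J -> is_ideal (ideal_add I J).
Proof.
move=> iI iJ; split.
- move=> f [g [h [Ig Jh E]]]; apply: near_eq_holomorphic0 (holD (ideal_hol iI Ig) (ideal_hol iJ Jh)).
  by near=> x; apply/esym; near: x.
- move=> f f' ff' [g [h [Ig Jh E]]]; exists g, h; split => //.
  by near=> x; rewrite -[f' x](_ : f x = _); near: x.
- exists (fun _ => 0), (fun _ => 0); split; [exact: ideal0|exact: ideal0|].
  by near=> x; rewrite addr0.
- move=> f f' [g [h [Ig Jh E]]] [g' [h' [Ig' Jh' E']]].
  exists (fun x => g x + g' x), (fun x => h x + h' x); split; [exact: idealD|exact: idealD|].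
  near=> x; rewrite addrACA; congr (_ + _); near: x; [exact: E|exact: E'].
- move=> a f ha [g [h [Ig Jh E]]].
  exists (fun x => a x * g x), (fun x => a x * h x); split; [exact: idealM|exact: idealM|].
  by near=> x; rewrite -mulrDr; congr (_ * _); near: x.
Unshelve. all: by end_near. Qed.

Lemma ideal_addl (I J : set (V -> C)) : is_ideal I -> is_ideal J -> I `<=` ideal_add I J.
Proof.
move=> iI iJ f If; exists f, (fun _ => 0); split => //; first exact: ideal0.
by near=> x; rewrite addr0.
Unshelve. all: by end_near. Qed.

Lemma ideal_addr (I J : set (V -> C)) : is_ideal I -> is_ideal J -> J `<=` ideal_add I J.
Proof.
move=> iI iJ f Jf; exists (fun _ => 0), f; split => //; first exact: ideal0.
by near=> x; rewrite add0r.
Unshelve. all: by end_near. Qed.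

Lemma ideal_add_sub (I J K : set (V -> C)) : is_ideal K -> I `<=` K -> J `<=` K ->
  ideal_add I J `<=` K.
Proof.
move=> iK IK JK f [g [h [Ig Jh E]]].
apply: (ideal_near iK _ (idealD iK (IK _ Ig) (JK _ Jh))).
by near=> x; apply/esym; near: x.
Unshelve. all: by end_near. Qed.

End DetCongruence.

(** * The ideals [tower s] and their description by the psi's *)

Section Tower.
Variables (C : numFieldType) (n r : nat).
Hypotheses (r_gt0 : (0 < r)%N) (le_rn : (r <= n)%N).
Local Notation V := ('rV[C]_(n + r)).
Local Notation dd := (@dd C n r).
Local Notation cc := (@cc C n r).
Local Notation quo_coef := (@quo_coef C n r).
Local Notation psi := (@psi C n r).
(** For R[i] this is [holomorphic0_partial]; as a hypothesis it separates the algebra from the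
    analysis. *)
Hypothesis hol_partial : forall k (F : V -> C), holomorphic0 F -> holomorphic0 (partial k F).

Lemma hol_quo_coef t j : holomorphic0 (quo_coef t j).
Proof. by apply: hol_everywhere => x; apply: quo_coef_diff. Qed.

Lemma hol_cc j : holomorphic0 (cc j).
Proof. by apply: hol_everywhere => x; apply: cc_diff. Qed.

Lemma hol_dd j : (j <= n)%N -> holomorphic0 (dd j).
Proof. by move=> jn; apply: hol_everywhere => x; apply: dd_diff. Qed.

(** d_(r-1) is the coefficient of 1/x in f/g. Differentiating along b_l turns f/g^t into - t x^l
    f/g^(t+1), which produces the sign and the factorial. The bound on u keeps the subtractions
    exact. *)
Lemma iter_partial_dd u i : (u.+2 * r <= n)%N -> (i < r)%N ->
  iter u (partial n) (partial (n + (r - 1 - i)) (dd (r - 1))) =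
  fun x => (-1) ^+ u.+1 * (u.+1)`!%:R * quo_coef u.+2 (n - u.+1 * r - i) x.
Proof.
move=> hu ir; elim: u hu => [|u IH] hu.
  apply/funext => x; rewrite /= (_ : dd (r - 1) = quo_coef 1 (n - (r - 1))); last first.
    by apply/funext => y; rewrite -dd_quo_coef ?leq_subr // subKn //; lia.
  rewrite partial_quo_coef //; last by lia.
  rewrite /quo_coef_shift (_ : (_ <= _)%N = true); last by lia.
  by rewrite mul1r expr1 mulr1 mulN1r; congr (- quo_coef _ _ _); lia.
rewrite iterS IH; last by nia.
apply/funext => x; rewrite (derivM (partial_derivation _ _ _)); last 2 first.
- exact: differentiable_cst.
- exact: quo_coef_diff.
rewrite (deriv_cst (partial_derivation _ _ _)) mul0r add0r.
have := partial_quo_coef r_gt0 le_rn u.+2 (n - u.+1 * r - i) x r_gt0; rewrite addn0 => ->.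
rewrite subn0 /quo_coef_shift (_ : (_ <= _)%N = true); last by nia.
rewrite (_ : (n - u.+1 * r - i - r = n - u.+2 * r - i)%N); last by nia.
rewrite (factS u.+1) natrM (exprS _ u.+1).
by move: ((-1) ^+ u.+1) (_`!%:R) (u.+2%:R) (quo_coef _ _ _) => a b c e; ring.
Qed.

Lemma psi_quo_coef t i : (t.+1 * r <= n)%N -> (i < r)%N ->
  psi (t * r + i) = fun x => (-1) ^+ t * t`!%:R * quo_coef t.+1 (n - t * r - i) x.
Proof.
move=> ht ir; rewrite /Defs.psi divnMDl // divn_small // addn0 modnMDl modn_small //.
case: t ht => [|t] ht /=.
  apply/funext => x; rewrite expr0 !mul1r mul0n subn0 -dd_quo_coef ?leq_subr // subKn //; lia.
by rewrite subSS subn0 iter_partial_dd.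
Qed.

(** Since g is monic, the relation g (f/g^(t+1)) = f/g^t determines the lower coefficients of
    f/g^(t+1) from those of x^(-1), ..., x^(-r) and the negative part of f/g^t. *)
Lemma quo_coef_ideal (K : set (V -> C)) t : is_ideal K ->
  (forall j, (n < j + t * r)%N -> K (quo_coef t j)) ->
  (forall j, (n < j + t.+1 * r)%N -> (j + t * r <= n)%N -> K (quo_coef t.+1 j)) ->
  forall j, (n < j + t.+1 * r)%N -> K (quo_coef t.+1 j).
Proof.
move=> iK H1 H2; elim/ltn_ind => j IH hj.
have [h|h] := leqP (j + t * r) n; first exact: H2.
rewrite (_ : quo_coef t.+1 j = fun x => quo_coef t j x -
    \sum_(k < j) @grev C n r k.+1 x * quo_coef t.+1 (j - k.+1) x).
  apply: (idealB iK); first exact: H1.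
  apply: ideal_sum => // k _; have hk := ltn_ord k.
  (* A shift by at most r stays among the negative powers; larger shifts have coefficient 0 in g. *)
  have [kr|kr] := leqP k.+1 r.
    apply: (idealM iK); first by apply: hol_everywhere => x; apply: grev_diff.
    by apply: IH; nia.
  by apply: (ideal_eq iK _ (ideal0 iK)) => x; rewrite grev_big // mul0r.
by apply/funext => x; rewrite quo_coef_rec.
Qed.

Lemma quo_coef0_ideal (K : set (V -> C)) j : is_ideal K -> (n < j)%N -> K (quo_coef 0 j).
Proof.
move=> iK nj; apply: (ideal_eq iK _ (ideal0 iK)) => x.
by rewrite quo_coef0 leqNgt nj.
Qed.

Lemma quo_coef1_ideal (K : set (V -> C)) : is_ideal K -> (forall l, (l < r)%N -> K (dd l)) ->
  forall j, (n < j + r)%N -> K (quo_coef 1 j).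
Proof.
move=> iK H j hj; apply: (@quo_coef_ideal K 0) => //; last by rewrite mul1n.
  by move=> l; rewrite mul0n addn0; apply: quo_coef0_ideal.
move=> l; rewrite mul1n mul0n addn0 => h1 h2.
rewrite (_ : quo_coef 1 l = dd (n - l)); first by apply: H; lia.
by apply/funext => x; rewrite dd_quo_coef.
Qed.

Definition tower_gen s : set (V -> C) :=
  [set f | (exists2 j, (j < n + r)%N & f = cc j) \/
           exists t j, [/\ (0 < t <= s)%N, (n < j + t * r)%N & f = quo_coef t j]].

(* Generated by the coefficients of [f g] and by all the coefficients of negative powers
   of [x] in [f / g], ..., [f / g^s]. *)
Definition tower s : set (V -> C) := ideal_gen (tower_gen s).

Lemma tower_ideal s : is_ideal (tower s).
Proof. exact: ideal_gen_ideal. Qed.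

Lemma tower_cc s j : (j < n + r)%N -> tower s (cc j).
Proof. by move=> h; apply: mem_ideal_gen; [exact: hol_cc|left; exists j]. Qed.

Lemma tower_quo_coef s t j : (0 < t <= s)%N -> (n < j + t * r)%N -> tower s (quo_coef t j).
Proof. by move=> h1 h2; apply: mem_ideal_gen; [exact: hol_quo_coef|right; exists t, j]. Qed.

Lemma tower_sub s (K : set (V -> C)) : is_ideal K -> (forall j, (j < n + r)%N -> K (cc j)) ->
  (forall t j, (0 < t <= s)%N -> (n < j + t * r)%N -> K (quo_coef t j)) -> tower s `<=` K.
Proof.
move=> iK H1 H2; apply: ideal_gen_sub => // f [[j h ->]|[t [j [h1 h2 ->]]]].
  exact: H1.
exact: H2.
Qed.

Lemma tower_leq s s' : (s <= s')%N -> tower s `<=` tower s'.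
Proof.
move=> ss'; apply: tower_sub; first exact: tower_ideal.
  by move=> j; apply: tower_cc.
by move=> t j /andP[t0 ts]; apply: tower_quo_coef; rewrite t0 (leq_trans ts).
Qed.

Lemma tower0 : tower 0 = Imu C n r.
Proof.
apply/seteqP; split.
  apply: tower_sub; first exact: ideal_gen_ideal.
    by move=> j h; apply: mem_ideal_gen; [exact: hol_cc|exists j].
  by move=> t j; lia.
apply: ideal_gen_sub; first exact: tower_ideal.
by move=> f [j h ->]; apply: tower_cc.
Qed.

(** The psi's are the coefficients of x^(-r), ..., x^(-1) in f/g, ..., f/g^s up to the invertible
    constants (-1)^t t!; [quo_coef_ideal] supplies the others. *)
Lemma tower_psi s : (s * r <= n)%N ->
  tower s = ideal_add (Imu C n r) (psi_ideal C n r (s * r)).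
Proof.
move=> sn.
have iI : is_ideal (Imu C n r) by apply: ideal_gen_ideal.
have iP : is_ideal (psi_ideal C n r (s * r)) by apply: ideal_gen_ideal.
have iA := ideal_add_ideal iI iP.
have E k : (k < s * r)%N -> exists t i, [/\ k = (t * r + i)%N, (i < r)%N & (t < s)%N].
  move=> ks; exists (k %/ r)%N, (k %% r)%N; split.
  - exact: divn_eq.
  - by rewrite ltn_mod.
  - by rewrite ltn_divLR.
have H t i : (t < s)%N -> (i < r)%N -> ideal_add (Imu C n r) (psi_ideal C n r (s * r))
    (quo_coef t.+1 (n - t * r - i)).
  move=> ts ir; have c0 : (-1) ^+ t * t`!%:R != 0 :> C.
    by rewrite mulf_neq0 ?expf_neq0 ?oppr_eq0 ?oner_eq0 // pnatr_eq0 -lt0n fact_gt0.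
  apply: (ideal_eq iA (f := fun x => ((-1) ^+ t * t`!%:R)^-1 * psi (t * r + i) x)).
    by move=> x; rewrite psi_quo_coef ?mulKf //; nia.
  apply: (idealM iA); first exact: hol_cst.
  apply: ideal_addr => //; apply: mem_ideal_gen; last by exists (t * r + i)%N => //; nia.
  rewrite psi_quo_coef //; last by nia.
  by apply: holM; [exact: hol_cst|exact: hol_quo_coef].
apply/seteqP; split.
  apply: tower_sub => //.
    move=> j h; apply: ideal_addl => //.
    by apply: mem_ideal_gen; [exact: hol_cc|exists j].
  move=> t j /andP[]; case: t => // t _.
  elim: t j => [|t IH] j ts.
    apply: quo_coef_ideal => //; first by move=> l; rewrite mul0n addn0; apply: quo_coef0_ideal.
    move=> l h1 h2; have := @H 0 (n - l)%N ts; rewrite mul0n subn0 subKn; [apply; lia|lia].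
  apply: quo_coef_ideal => //; first by move=> l; apply: IH; lia.
  move=> l h1 h2; have := @H t.+1 (n - t.+1 * r - l)%N ts.
  rewrite subKn; [apply; nia|lia].
apply: ideal_add_sub; first exact: tower_ideal.
  by rewrite -tower0; apply: tower_leq.
apply: ideal_gen_sub; first exact: tower_ideal.
move=> f [k ks ->]; have [t [i [-> ir ts]]] := E k ks.
rewrite psi_quo_coef //; last by nia.
apply: (idealM (tower_ideal s)); first exact: hol_cst.
apply: tower_quo_coef; first by lia.
nia.
Qed.

Lemma hol_tangent i (F : V -> C) : (i < r)%N -> holomorphic0 F -> holomorphic0 (tangent i F).
Proof.
move=> ir hF; apply: holB; first exact: hol_partial.
apply: hol_sum => k _; apply: holM; last exact: hol_partial.
by apply: hol_dd; have := ltn_ord k; lia.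
Qed.

Lemma tower1_dd s l : (l < r)%N -> tower s.+1 (dd l).
Proof.
move=> lr; rewrite (_ : dd l = quo_coef 1 (n - l)); first by apply: tower_quo_coef => //; lia.
by apply/funext => x; rewrite -dd_quo_coef ?leq_subr // subKn //; lia.
Qed.

(** It suffices to treat generators: c_j goes to a coefficient of x^i times the remainder, a
    combination of d_0, ..., d_(r-1), and f/g^t goes to a multiple of x^i f/g^(t+1) modulo
    [tower s.+1]. *)
Lemma tangent_tower i s (F : V -> C) : (i < r)%N -> tower s F -> tower s.+1 (tangent i F).
Proof.
move=> ir; have iT := tower_ideal s.+1.
apply: deriv_ideal => //; first exact: tangent_derivation.
  by move=> G; apply: hol_tangent.
move=> G [[j h ->]|[t [j [/andP[t0 ts] h ->]]]]; split.
- exact: hol_cc.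
- exact: tower_cc.
- apply: (ideal_eq iT (f := fun x => if (j < i)%N then 0 else
     \sum_(l < r) dd l x * (poly_g x)`_(r + (j - i) - l))).
    by move=> x; rewrite tangent_cc // coefXnM coef_rem_poly.
  case: ltnP => _; first exact: ideal0.
  apply: ideal_sum => // l _; apply: (idealMr iT); last by apply: tower1_dd.
  by apply: hol_everywhere => x; apply: coef_poly_g_diff.
- exact: hol_quo_coef.
- by apply: tower_quo_coef => //; lia.
have H1 l : (n < l + r)%N -> tower s.+1 (quo_coef 1 l) by move=> hl; apply: tower_quo_coef; rewrite ?mul1n.
have iE := tangent_quo_coef r_gt0 le_rn t j iT ir H1.
have H : tower s.+1 (fun x => (1 + t%:R) * quo_coef_shift t.+1 j (r - i) x).
  apply: (idealM iT); first exact: hol_cst.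
  rewrite /quo_coef_shift; case: leqP => h2; last exact: ideal0.
  by apply: (@tower_quo_coef s.+1 t.+1 (j - (r - i))); nia.
by apply: (ideal_eq iT _ (idealB iT iE H)) => x; rewrite addrK.
Qed.

End Tower.

(** * One application of the operator raises the tower by one step *)

Section DeltaTower.
Variables (C : numFieldType) (n r : nat).
Hypotheses (r_gt0 : (0 < r)%N) (le_rn : (r <= n)%N).
Local Notation V := ('rV[C]_(n + r)).
Local Notation dd := (@dd C n r).
Local Notation cc := (@cc C n r).
Local Notation tower := (@tower C n r).
Hypothesis hol_partial : forall k (F : V -> C), holomorphic0 F -> holomorphic0 (partial k F).

(* Modulo [tangent _ F], the columns [b_i] of a Jacobian matrix are combinations of its
   columns [a_l] with these coefficients. *)
Definition tangent_coef (l j : nat) (x : V) : C :=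
  if (j < n)%N then (j == l)%:R
  else \sum_(k < (n - r).+1) ((j - n) + k == l)%N%:R * dd (r + k) x.

Lemma hol_tangent_coef l j : holomorphic0 (tangent_coef l j).
Proof.
rewrite /tangent_coef; case: ltnP => _; first exact: hol_cst.
apply: hol_sum => k _; apply: holM; first exact: hol_cst.
by apply: hol_dd => //; have := ltn_ord k; lia.
Qed.

Lemma partial_tangent (F : V -> C) (j : 'I_(n + r)) x :
  partial j F x - \sum_(l < n) partial l F x * tangent_coef l j x =
  if (j < n)%N then 0 else tangent (j - n) F x.
Proof.
rewrite /tangent_coef; case: ltnP => jn.
  rewrite (bigD1 (Ordinal jn)) //= eqxx mulr1 big1 ?addr0 ?subrr // => l /eqP nl.
  by case: eqP => [e|_]; [case: nl; apply: val_inj|rewrite mulr0].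
rewrite /tangent subnKC //; congr (_ - _).
under eq_bigr do rewrite mulr_sumr.
rewrite exchange_big /=; apply: eq_bigr => k _.
have hk : (j - n + k < n)%N by have := ltn_ord k; have := ltn_ord j; lia.
rewrite (bigD1 (Ordinal hk)) //= eqxx mul1r big1 ?addr0 1?mulrC // => l /eqP nl.
by case: eqP => [e|_]; [case: nl; apply: val_inj|rewrite mul0r mulr0].
Qed.

(** Replacing every column b_i by its combination of the columns a_l changes the minor by an element
    of [tower s.+1]. The new matrix factors through n columns, so its determinant is 0. *)
Lemma jacobian_minors_tower s k : (n < k)%N ->
  jacobian_minors k (tower s) `<=` tower s.+1.
Proof.
move=> nk D [p [F [u [v [JF _ _ ->]]]]].
have iT := @tower_ideal C n r s.+1.
pose X a b x := partial (v b) (F (u a)) x.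
pose Y a b x := \sum_(l < n) partial l (F (u a)) x * tangent_coef l (v b) x.
have hF a : holomorphic0 (F a) := ideal_hol (tower_ideal _ _ _ s) (JF a).
have XY : tower s.+1 (fun x => \det (\matrix_(a, b) X a b x) - \det (\matrix_(a, b) Y a b x)).
  apply: det_cong => //.
  - by move=> a b; apply: hol_partial.
  - move=> a b; apply: hol_sum => l _; apply: holM; first exact: hol_partial.
    exact: hol_tangent_coef.
  move=> a b; apply: (ideal_eq iT (f := fun x => if (v b < n)%N then 0 else tangent (v b - n) (F (u a)) x)).
    by move=> x; rewrite -partial_tangent.
  case: ltnP => h; first exact: ideal0.
  by apply: tangent_tower => //; have := ltn_ord (v b); lia.
apply: (ideal_eq iT _ XY) => x.
rewrite [X in _ - X](_ : _ = 0) ?subr0.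
  by congr (\det _); apply/matrixP => a b; rewrite !mxE.
pose A := \matrix_(a < k, l < n) partial l (F (u a)) x.
pose B := \matrix_(l < n, b < k) tangent_coef l (v b) x.
rewrite (_ : \matrix_(a, b) _ = A *m B) ?det_mulmx_small //.
by apply/matrixP => a b; rewrite !mxE; apply: eq_bigr => l _; rewrite !mxE.
Qed.

Lemma partial_a_cc_top (a b : nat) (x : V) : (b < n)%N -> (b <= a)%N ->
  partial b (cc (r + a)) x = (a == b)%:R.
Proof.
move=> bn ba; rewrite partial_a_cc // coefXnM coef_poly_g.
case: ltnP => h; first by lia.
case: ltnP => h2; first by lia.
by congr (_%:R); lia.
Qed.

(** The rows are c_r, ..., c_(n+r-1), F and the columns a_0, ..., a_(n-1), b_0. A unimodular column
    operation turns column b_0 into the values of [tangent 0] on the rows. *)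
Lemma tangent0_minor (F : V -> C) (J : set (V -> C)) : J F ->
  (forall j, (j < n + r)%N -> J (cc j)) ->
  jacobian_minors n.+1 J (tangent 0 F).
Proof.
move=> JF Jc.
pose Fam (a : 'I_n.+1) := if (a < n)%N then cc (r + a) else F.
have hv : (n.+1 <= n + r)%N by lia.
exists n.+1, Fam, id, (widen_ord hv); split => //.
  by move=> a; rewrite /Fam; case: ltnP => h //; apply: Jc; lia.
apply/funext => x.
pose M : 'M[C]_n.+1 := \matrix_(a, b) partial b (Fam a) x.
rewrite (_ : mxsub _ _ _ = M); last by apply/matrixP => a b; rewrite !mxE.
(* [U] subtracts from column b_0 its combination of the other columns. *)
pose U : 'M[C]_n.+1 := \matrix_(a, b)
   if (b < n)%N then (a == b)%:R else if (a < n)%N then - tangent_coef a n x else 1.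
have detU : \det U = 1.
  rewrite -det_tr det_trig; last first.
    apply/is_trig_mxP => a b ab; rewrite !mxE.
    have -> : (a < n)%N by have := ltn_ord b; lia.
    by rewrite (_ : b == a = false) //; apply/eqP => e; rewrite e ltnn in ab.
  by rewrite big1 // => a _; rewrite !mxE; case: ltnP => h; rewrite ?eqxx // ltnNge h.
have MUlast a : (M *m U) a ord_max = tangent 0 (Fam a) x.
  rewrite mxE big_ord_recr /= !mxE ltnn mulr1 addrC.
  have := partial_tangent (Fam a) (Ordinal hv) x; rewrite /= ltnn subnn => <-.
  congr (_ + _); rewrite -sumrN; apply: eq_bigr => l _.
  by rewrite !mxE /= ltnn ltn_ord mulrN.
have MUother a (b : 'I_n.+1) : (b < n)%N -> (M *m U) a b = partial b (Fam a) x.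
  move=> bn; rewrite mxE (bigD1 b) //= !mxE bn eqxx mulr1 big1 ?addr0 // => l lb.
  by rewrite !mxE bn (negbTE lb) mulr0.
have -> : \det M = \det (M *m U) by rewrite det_mulmx detU mulr1.
(* In the last column c_(r+a) contributes the coefficient of degree r + a of the remainder, which is
   0; only the row of F survives. *)
rewrite (expand_det_col _ ord_max) big_ord_recr /= big1 ?add0r; last first.
  move=> a _; rewrite MUlast /Fam /= ltn_ord tangent_cc // coefXnM subn0.
  by rewrite coef_rem_poly_big ?mul0r ?leq_addr.
rewrite MUlast /Fam /= ltnn /cofactor -signr_odd addnn odd_double expr0 mul1r.
(* The remaining block is triangular with diagonal 1, as g is monic. *)
rewrite -det_tr det_trig ?big1 ?mulr1 //.
  move=> a _; rewrite 3!mxE MUother /Fam lift_max ltn_ord //.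
  by rewrite partial_a_cc_top ?eqxx // ltn_ord.
apply/is_trig_mxP => a b ab; rewrite 3!mxE MUother /Fam ?lift_max ?ltn_ord //.
by rewrite partial_a_cc_top ?(gtn_eqF ab) ?ltn_ord // ltnW.
Qed.

Lemma delta_tower s : Delta_up C (n + r) r (tower s) = tower s.+1.
Proof.
rewrite /Delta_up /Delta_lo (_ : (n + r - r + 1 = n.+1)%N); last by lia.
set K := ideal_gen _.
have iK : is_ideal K by apply: ideal_gen_ideal.
have iT s' := @tower_ideal C n r s'.
apply/seteqP; split.
  apply: ideal_gen_sub => // f [].
    by apply: tower_leq.
  by apply: jacobian_minors_tower.
have sK : tower s `<=` K.
  by move=> f sf; apply: mem_ideal_gen; [exact: ideal_hol sf|left].
have tK F : tower s F -> K (tangent 0 F).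
  move=> sF; apply: mem_ideal_gen.
    by apply: hol_tangent => //; exact: ideal_hol sF.
  by right; apply: tangent0_minor => // j; apply: tower_cc.
(* For s = 0 these coefficients are not among the generators and are extracted from the remainder of
   f by g. *)
have K1 : forall j, (n < j + r)%N -> K (quo_coef 1 j).
  case: s @K iK sK tK => [|s] K iK sK tK; last first.
    by move=> j hj; apply: sK; apply: tower_quo_coef; rewrite ?mul1n.
  apply: quo_coef1_ideal => // l lr.
  have Rl p : (p < r)%N -> K (fun x => \sum_(l < r) dd l x * (poly_g x)`_(r + p - l)).
    move=> pr; have := tK _ (tower_cc _ _ (ltn_addl n pr)) => H.
    apply: (ideal_eq iK _ H).
    by move=> x; rewrite tangent_cc // coefXnM subn0 coef_rem_poly.
  (* The coefficients of the remainder form a unitriangular system in d_0, ..., d_(r-1), which is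
     solved from d_(r-1) downwards. *)
  have [m hm] : exists m, m = (r - l)%N by exists (r - l)%N.
  elim/ltn_ind: m l lr hm => m IH l lr hm.
  pose rest x := \sum_(i < r | i != Ordinal lr) dd i x * (poly_g x)`_(r + l - i).
  apply: (ideal_eq iK (f := fun x => \sum_(i < r) dd i x * (poly_g x)`_(r + l - i) - rest x)).
    move=> x; rewrite (bigD1 (Ordinal lr)) //= addrK addnK coef_poly_g ltnn eqxx mulr1 //.
  apply: (idealB iK (Rl l lr)); apply: ideal_sum => // i /eqP il.
  have [li|li] := ltnP l i.
    apply: (idealMr iK); first by apply: hol_everywhere => x; apply: coef_poly_g_diff.
    by apply: (IH (r - i)%N) => //; have := ltn_ord i; lia.
  apply: (ideal_eq iK _ (ideal0 iK)) => x; rewrite coef_poly_g.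
  have ne : i <> l :> nat by move=> e; apply: il; apply: val_inj.
  have -> : (r + l - i < r)%N = false by lia.
  by rewrite gtn_eqF ?mulr0 //; lia.
apply: tower_sub => //.
  by move=> j hj; apply: sK; apply: tower_cc.
move=> t j /andP[t0]; rewrite leq_eqVlt => /orP[/eqP ts|ts] hj; last first.
  by apply: sK; apply: tower_quo_coef => //; rewrite t0.
have [s0|s0] := posnP s; first by rewrite ts s0; apply: K1; rewrite ts s0 mul1n in hj.
(* Multiplication by y^r turns index j into j + r, so [tangent 0] on the coefficient j + r of f/g^s
   yields - (1 + s) times the coefficient j of f/g^(s+1) modulo [K]. *)
have T := tangent_quo_coef r_gt0 le_rn s (j + r) iK r_gt0 K1.
have sT : K (tangent 0 (quo_coef s (j + r))).
  by apply: tK; apply: tower_quo_coef; rewrite ?s0 ?leqnn //; rewrite ts in hj; lia.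
have c0 : 1 + s%:R != 0 :> C by rewrite nat1r pnatr_eq0.
apply: (ideal_eq iK (f := fun x => (1 + s%:R)^-1 *
   ((tangent 0 (quo_coef s (j + r)) x + (1 + s%:R) * quo_coef_shift s.+1 (j + r) (r - 0) x)
     - tangent 0 (quo_coef s (j + r)) x))).
  move=> x; rewrite (addrAC (tangent _ _ _)) subrr add0r mulKf // /quo_coef_shift subn0 leq_addl addnK ts //.
by apply: (idealM iK); [exact: hol_cst|exact: idealB].
Qed.

End DeltaTower.

Theorem theorem3p6 (R : realType) (n r q1 r1 : nat) :
  (1 <= r)%N -> (r <= n)%N -> n = (q1 * r + r1)%N -> (r1 < r)%N ->
  forall s : nat, (1 <= s <= q1)%N ->
    iter s (Delta_up R[i]%C (n + r) r) (Imu R[i]%C n r) =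
    ideal_add (Imu R[i]%C n r) (psi_ideal R[i]%C n r (s * r)).
Proof.
move=> r0 rn nE _ s /andP[_ sq].
have hol k F := @holomorphic0_partial R (n + r) k F.
(* The right-hand side is [tower s], so an induction on s with [delta_tower] remains. *)
rewrite -(@tower_psi _ _ _ r0 rn s); last by nia.
elim: s {sq} => [|s IH] /=; first by rewrite tower0.
by rewrite IH; apply: delta_tower.
Qed.
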